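(* Every $3$-cosymplectic manifold $(M^{4n+3},\phi_\alpha,\xi_\alpha,\eta_\alpha,g)$ is Ricci-flat, i.e. the Ricci tensor of $g$ vanishes identically.
   Context: An almost contact structure on an odd-dimensional manifold $M$ is a triple $(\phi,\xi,\eta)$ with $\phi$ a $(1,1)$-tensor field, $\xi$ a vector field, $\eta$ a $1$-form, such that $\phi^2=-I+\eta\otimes\xi$, $\eta(\xi)=1$. It is normal if $[\phi,\phi]+2d\eta\otimes\xi=0$, where $[\phi,\phi]$ is the Nijenhuis tensor of $\phi$ and $2d\eta(E,F)=E(\eta(F))-F(\eta(E))-\eta([E,F])$. A Riemannian metric $g$ is compatible if $g(\phi E,\phi F)=g(E,F)-\eta(E)\eta(F)$; then the fundamental $2$-form is $\Phi(E,F)=g(E,\phi F)$. An almost $3$-contact metric manifold is a $(4n+3)$-dimensional smooth manifold with three almost contact structures $(\phi_\alpha,\xi_\alpha,\eta_\alpha)$, $\alpha\in\{1,2,3\}$, and a Riemannian metric $g$ compatible with each of them, such that for all $\alpha,\beta$: $\phi_\alpha\phi_\beta-\eta_\beta\otimes\xi_\alpha=\sum_\gamma\epsilon_{\alpha\beta\gamma}\phi_\gamma-\delta_{\alpha\beta}I$, $\phi_\alpha\xi_\beta=\sum_\gamma\epsilon_{\alpha\beta\gamma}\xi_\gamma$, $\eta_\alpha\circ\phi_\beta=\sum_\gamma\epsilon_{\alpha\beta\gamma}\eta_\gamma$, where $\epsilon_{\alpha\beta\gamma}$ is the totally antisymmetric symbol. It is $3$-cosymplectic if for each $\alpha$ one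 has $d\eta_\alpha=0$, $d\Phi_\alpha=0$ and the structure $(\phi_\alpha,\xi_\alpha,\eta_\alpha)$ is normal. *)

(* Defs.v *)
From HB Require Import structures.
From mathcomp Require Import all_boot all_order all_algebra.
From mathcomp Require Import all_classical all_reals all_analysis.
Set Implicit Arguments.
Unset Strict Implicit.
Unset Printing Implicit Defensive.
Import Order.TTheory GRing.Theory Num.Theory.
Import numFieldNormedType.Exports.
Local Open Scope classical_set_scope.
Local Open Scope ring_scope.

Section Calculus.
Variables (R : realType) (d : nat).
Implicit Types (U : set 'rV[R]_d) (f : 'rV[R]_d -> R).

Definition partial (i : 'I_d) f : 'rV[R]_d -> R := 'D_(delta_mx 0 i) f.

(* C^oo on the open set U: all iterated partial derivatives exist and are
   continuous at every point of U. *)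
Definition smooth_on U f : Prop :=
  forall (s : seq 'I_d) (x : 'rV[R]_d), U x ->
    {for x, continuous (foldr partial f s)} /\
    forall i : 'I_d, derivable (foldr partial f s) x (delta_mx 0 i).

Definition smooth_mx_on m n U (A : 'rV[R]_d -> 'M[R]_(m, n)) : Prop :=
  forall i j, smooth_on U (fun x => A x i j).

End Calculus.

Record chart (R : realType) (d : nat) (M : topologicalType) := Chart {
  chart_dom : set M;
  chart_map : M -> 'rV[R]_d;
  chart_inv : 'rV[R]_d -> M;
  chart_dom_open : open chart_dom;
  chart_im_open : open (chart_map @` chart_dom);
  chart_mapK : forall p, chart_dom p -> chart_inv (chart_map p) = p;
  chart_map_continuous : {within chart_dom, continuous chart_map};
  chart_inv_continuous : {within chart_map @` chart_dom, continuous chart_inv} }.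

Definition chart_im (R : realType) (d : nat) (M : topologicalType)
  (c : chart R d M) : set 'rV[R]_d := chart_map c @` chart_dom c.

Definition overlap (R : realType) (d : nat) (M : topologicalType)
  (c c' : chart R d M) : set 'rV[R]_d :=
  chart_map c @` (chart_dom c `&` chart_dom c').

Definition transition (R : realType) (d : nat) (M : topologicalType)
  (c c' : chart R d M) : 'rV[R]_d -> 'rV[R]_d := chart_map c' \o chart_inv c.

(* The atlas is not required to be maximal: a tensor field given on an atlas
   extends uniquely to the maximal one. *)
Record manifold (R : realType) (d : nat) := Manifold {
  carrier : topologicalType;
  carrier_hausdorff : hausdorff_space carrier;
  carrier_second_countable : @second_countable carrier;
  chart_index : Type;
  atlas : chart_index -> chart R d carrier;
  atlas_cover : forall p : carrier, exists c, chart_dom (atlas c) p;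
  transition_smooth : forall c c',
    smooth_mx_on (overlap (atlas c) (atlas c'))
                 (transition (atlas c) (atlas c')) }.
Arguments atlas {R d} m c.

(* Tensor fields are given by their components in every chart c of the atlas,
   as functions of the coordinates; only the values on the image of c matter.
   Tangent vectors are row vectors and covectors are column vectors, so that a
   1-form w, an endomorphism A and a bilinear form g act as follows. *)
Section PointwiseAlgebra.
Variables (R : realType) (d : nat).
Implicit Types v w : 'rV[R]_d.

Definition app1 (a : 'cV[R]_d) v : R := (v *m a) 0 0.
Definition appE (A : 'M[R]_d) v : 'rV[R]_d := v *m A.
Definition app2 (g : 'M[R]_d) v w : R := (v *m g *m w^T) 0 0.

End PointwiseAlgebra.

Section TensorFields.
Variables (R : realType) (d : nat) (M : manifold R d).

Local Notation I := (chart_index M).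
Local Notation Omega c := (chart_im (atlas M c)).
Local Notation Omega2 c c' := (overlap (atlas M c) (atlas M c')).
Local Notation tau c c' := (transition (atlas M c) (atlas M c')).

Record vector_field := VectorField {
  vf_comp :> I -> 'rV[R]_d -> 'rV[R]_d;
  vf_smooth : forall c, smooth_mx_on (Omega c) (vf_comp c);
  vf_transform : forall c c' x, Omega2 c c' x ->
    vf_comp c' (tau c c' x) = 'd (tau c c') x (vf_comp c x) }.

Record one_form := OneForm {
  of_comp :> I -> 'rV[R]_d -> 'cV[R]_d;
  of_smooth : forall c, smooth_mx_on (Omega c) (of_comp c);
  of_transform : forall c c' x, Omega2 c c' x -> forall v : 'rV[R]_d,
    app1 (of_comp c' (tau c c' x)) ('d (tau c c') x v) =
    app1 (of_comp c x) v }.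

Record endo_field := EndoField {
  ef_comp :> I -> 'rV[R]_d -> 'M[R]_d;
  ef_smooth : forall c, smooth_mx_on (Omega c) (ef_comp c);
  ef_transform : forall c c' x, Omega2 c c' x -> forall v : 'rV[R]_d,
    appE (ef_comp c' (tau c c' x)) ('d (tau c c') x v) =
    'd (tau c c') x (appE (ef_comp c x) v) }.

Record riemannian_metric := RiemannianMetric {
  rm_comp :> I -> 'rV[R]_d -> 'M[R]_d;
  rm_smooth : forall c, smooth_mx_on (Omega c) (rm_comp c);
  rm_transform : forall c c' x, Omega2 c c' x -> forall v w : 'rV[R]_d,
    app2 (rm_comp c' (tau c c' x)) ('d (tau c c') x v) ('d (tau c c') x w) =
    app2 (rm_comp c x) v w;
  rm_sym : forall c x, Omega c x -> forall v w,
    app2 (rm_comp c x) v w = app2 (rm_comp c x) w v;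
  rm_pos : forall c x, Omega c x -> forall v : 'rV[R]_d, v != 0 ->
    0 < app2 (rm_comp c x) v v }.

End TensorFields.

Section LocalOperators.
Variables (R : realType) (d : nat).
Local Notation V := 'rV[R]_d.
Implicit Types (E F G : V -> V) (f : V -> R) (w : V -> 'cV[R]_d)
  (A : V -> 'M[R]_d) (g : V -> 'M[R]_d) (om : V -> V -> V -> R).

Definition pair1 w E : V -> R := fun x => app1 (w x) (E x).
Definition applyE A E : V -> V := fun x => appE (A x) (E x).

Definition dir E f : V -> R := fun x => \sum_i E x 0 i * partial i f x.

Definition lie_bracket E F : V -> V := fun x =>
  \row_k (dir E (fun y => F y 0 k) x - dir F (fun y => E y 0 k) x).

(* d is normalised by 1/(k+1) on k-forms: 2 d eta (E, F) = E(eta F) - ... *)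
Definition d1 w E F : V -> R := fun x =>
  2%:R^-1 * (dir E (pair1 w F) x - dir F (pair1 w E) x
             - pair1 w (lie_bracket E F) x).

Definition d2 om E F G : V -> R :=
  let ev E F : V -> R := fun y => om y (E y) (F y) in
  fun x =>
  3%:R^-1 * (dir E (ev F G) x + dir F (ev G E) x + dir G (ev E F) x
             - ev (lie_bracket E F) G x - ev (lie_bracket F G) E x
             - ev (lie_bracket G E) F x).

(* [A, A](E, F) =
     A^2 [E, F] + [A E, A F] - A [A E, F] - A [E, A F]. *)
Definition nijenhuis A E F : V -> V := fun x =>
  applyE A (applyE A (lie_bracket E F)) x
  + lie_bracket (applyE A E) (applyE A F) x
  - applyE A (lie_bracket (applyE A E) F) x
  - applyE A (lie_bracket E (applyE A F)) x.

(* Gamma^k_ij of the Levi-Civita connection. *)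
Definition christoffel g (k i j : 'I_d) : V -> R := fun x =>
  2%:R^-1 * \sum_l invmx (g x) k l *
    (partial i (fun y => g y j l) x + partial j (fun y => g y i l) x
     - partial l (fun y => g y i j) x).

Definition nabla g E F : V -> V := fun x =>
  \row_k (dir E (fun y => F y 0 k) x
          + \sum_i \sum_j christoffel g k i j x * E x 0 i * F x 0 j).

Definition curvature g E F G : V -> V := fun x =>
  nabla g E (nabla g F G) x - nabla g F (nabla g E G) x
  - nabla g (lie_bracket E F) G x.

(* Trace of E |-> R(E, F) G, computed in the coordinate frame. *)
Definition ricci g F G : V -> R := fun x =>
  \sum_i curvature g (fun=> delta_mx 0 i) F G x 0 i.

End LocalOperators.

(* Identities between tensor fields are local: they are tested at each point x
   of each chart image, on tangent vectors v w when no derivative occurs, and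
   otherwise on the smooth vector fields E F G of the chart domain. *)
Section Structures.
Variables (R : realType) (d : nat) (M : manifold R d).

Record almost_contact := AlmostContact {
  ac_phi : endo_field M;
  ac_xi : vector_field M;
  ac_eta : one_form M;
  ac_phi2 : forall c x, chart_im (atlas M c) x -> forall v,
    appE (ac_phi c x) (appE (ac_phi c x) v) =
    - v + app1 (ac_eta c x) v *: ac_xi c x;
  ac_eta_xi : forall c x, chart_im (atlas M c) x ->
    app1 (ac_eta c x) (ac_xi c x) = 1 }.

Definition compatible (g : riemannian_metric M) (S : almost_contact) : Prop :=
  forall c x, chart_im (atlas M c) x -> forall v w,
    app2 (g c x) (appE (ac_phi S c x) v) (appE (ac_phi S c x) w) =
    app2 (g c x) v w - app1 (ac_eta S c x) v * app1 (ac_eta S c x) w.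

Definition fundamental_form (g : riemannian_metric M) (S : almost_contact)
    (c : chart_index M) (x v w : 'rV[R]_d) : R :=
  app2 (g c x) v (appE (ac_phi S c x) w).

Definition normal (S : almost_contact) : Prop :=
  forall c (E F : 'rV[R]_d -> 'rV[R]_d),
    smooth_mx_on (chart_im (atlas M c)) E ->
    smooth_mx_on (chart_im (atlas M c)) F ->
    forall x, chart_im (atlas M c) x ->
      nijenhuis (ac_phi S c) E F x
      + (2%:R * d1 (ac_eta S c) E F x) *: ac_xi S c x = 0.

Definition eta_closed (S : almost_contact) : Prop :=
  forall c (E F : 'rV[R]_d -> 'rV[R]_d),
    smooth_mx_on (chart_im (atlas M c)) E ->
    smooth_mx_on (chart_im (atlas M c)) F ->
    forall x, chart_im (atlas M c) x -> d1 (ac_eta S c) E F x = 0.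

Definition Phi_closed (g : riemannian_metric M) (S : almost_contact) : Prop :=
  forall c (E F G : 'rV[R]_d -> 'rV[R]_d),
    smooth_mx_on (chart_im (atlas M c)) E ->
    smooth_mx_on (chart_im (atlas M c)) F ->
    smooth_mx_on (chart_im (atlas M c)) G ->
    forall x, chart_im (atlas M c) x ->
      d2 (fundamental_form g S c) E F G x = 0.

Definition ricci_flat (g : riemannian_metric M) : Prop :=
  forall c (F G : 'rV[R]_d -> 'rV[R]_d),
    smooth_mx_on (chart_im (atlas M c)) F ->
    smooth_mx_on (chart_im (atlas M c)) G ->
    forall x, chart_im (atlas M c) x -> ricci (g c) F G x = 0.

End Structures.

(* Totally antisymmetric symbol: the exponent counts the inversions. *)
Definition epsilon (R : realType) (a b c : 'I_3) : R :=
  if uniq [:: a; b; c] then (-1) ^+ ((b < a) + (c < a) + (c < b))%N else 0.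

Record almost_3contact_metric (R : realType) (n : nat)
    (M : manifold R (4 * n + 3)) := Almost3ContactMetric {
  a3_str : 'I_3 -> almost_contact M;
  a3_metric : riemannian_metric M;
  a3_compatible : forall a, compatible a3_metric (a3_str a);
  a3_phi_phi : forall a b c x, chart_im (atlas M c) x -> forall v,
    appE (ac_phi (a3_str a) c x) (appE (ac_phi (a3_str b) c x) v)
    - app1 (ac_eta (a3_str b) c x) v *: ac_xi (a3_str a) c x =
    \sum_k epsilon R a b k *: appE (ac_phi (a3_str k) c x) v
    - (a == b)%:R *: v;
  a3_phi_xi : forall a b c x, chart_im (atlas M c) x ->
    appE (ac_phi (a3_str a) c x) (ac_xi (a3_str b) c x) =
    \sum_k epsilon R a b k *: ac_xi (a3_str k) c x;
  a3_eta_phi : forall a b c x, chart_im (atlas M c) x -> forall v,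
    app1 (ac_eta (a3_str a) c x) (appE (ac_phi (a3_str b) c x) v) =
    \sum_k epsilon R a b k * app1 (ac_eta (a3_str k) c x) v }.

Definition three_cosymplectic (R : realType) (n : nat)
    (M : manifold R (4 * n + 3)) (S : almost_3contact_metric M) : Prop :=
  forall a : 'I_3,
    [/\ eta_closed (a3_str S a),
        Phi_closed (a3_metric S) (a3_str S a)
      & normal (a3_str S a)].

(* Main.v *)
From HB Require Import structures.
Require Import Defs.
From mathcomp Require Import all_boot all_order all_algebra.
From mathcomp Require Import all_classical all_reals all_analysis.
From mathcomp Require Import ring lra.
Set Implicit Arguments.
Unset Strict Implicit.
Unset Printing Implicit Defensive.
Import Order.TTheory GRing.Theory Num.Theory.
Import numFieldNormedType.Exports.
Local Open Scope classical_set_scope.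
Local Open Scope ring_scope.

(* For an almost contact metric structure with d eta = 0, d Phi = 0 and
   phi normal, phi is parallel.  Put A(X,Y,Z) = g((nabla_X phi) Y, Z): it is
   skew in Y, Z, and its cyclic sum vanishes because Phi is closed.  Normality
   then reads a + b = c for a = A(phi X,Y,Z), b = A(phi Y,Z,X),
   c = A(phi Z,X,Y); cycling X, Y, Z gives a = b = c = 0, and the remaining
   components along xi vanish because nabla_xi xi = 0.

   Hence the curvature R(X,Y) commutes with phi_1, phi_2, phi_3 and kills the
   xi_a.  Since phi_c is, up to rank one terms killed by R(X,Y), the product of
   the other two in either order with opposite signs, tr(R(X,Y) phi_c) = 0.
   The first Bianchi identity turns this into Ric(X, phi_c Y) = Ric(phi_c X, Y),
   and writing phi_c again as a product gives Ric(X, phi_c Y) =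
   - Ric(phi_c X, Y), so Ric = 0.

   In a chart, vectors are rows, nabla_i F = d_i F + F Gamma_i with Gamma_i =
   connection_mx g i, and R(e_i, e_j) acts on rows as curvature_mx g i j. *)

(** * Derivatives of matrix-valued functions *)

Section MatrixDerivatives.
Variables (R : realType) (V : normedModType R).

Lemma is_derive_mxP m n (M : V -> 'M[R]_(m, n)) (dM : 'M[R]_(m, n)) x v :
  is_derive x v M dM <->
  forall i j, is_derive x v (fun y => M y i j) (dM i j).
Proof.
split=> [[Mx <-] i j|dMx].
  apply: DeriveDef; first exact: ((derivable_mxP _ _ _).1 Mx).
  by rewrite derive_mx// mxE.
have Mx : derivable M x v.
  by apply/(derivable_mxP _ _ _).2 => i j; have [] := dMx i j.
apply: DeriveDef => //; rewrite derive_mx//; apply/matrixP => i j.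
by rewrite mxE; have [_] := dMx i j.
Qed.

Lemma is_derive_mulmx m n p (A : V -> 'M[R]_(m, n)) (B : V -> 'M[R]_(n, p))
    (dA : 'M[R]_(m, n)) (dB : 'M[R]_(n, p)) x v :
  is_derive x v A dA -> is_derive x v B dB ->
  is_derive x v (fun y => A y *m B y) (dA *m B x + A x *m dB).
Proof.
move=> /is_derive_mxP hA /is_derive_mxP hB; apply/is_derive_mxP => i j.
rewrite (_ : (fun y => _) =
    \sum_k ((fun y => A y i k) * (fun y => B y k j))); last first.
  by apply/funext => y; rewrite mxE fct_sumE.
have H : is_derive x v (\sum_k ((fun y => A y i k) * (fun y => B y k j)))
    (\sum_k (A x i k *: dB k j + B x k j *: dA i k)).
  by apply: is_derive_sum => k; apply: is_deriveM.
apply: is_derive_eq.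
rewrite !mxE -big_split/=; apply: eq_bigr => k _.
by rewrite addrC; congr (_ + _); exact: mulrC.
Qed.

Lemma is_derive_trmx m n (A : V -> 'M[R]_(m, n)) (dA : 'M[R]_(m, n)) x v :
  is_derive x v A dA -> is_derive x v (fun y => (A y)^T) dA^T.
Proof.
move=> /is_derive_mxP hA; apply/is_derive_mxP => i j.
rewrite mxE (_ : (fun y => _) = (fun y => A y j i))//.
by apply/funext => y; rewrite mxE.
Qed.

Lemma derivable_bigprod (I : Type) (r : seq I) (f : I -> V -> R) x v :
  (forall i, derivable (f i) x v) ->
  derivable (fun y => \prod_(i <- r) f i y) x v.
Proof.
move=> df; elim: r => [|i r IH].
  by under eq_fun do rewrite big_nil; exact: derivable_cst.
by under eq_fun do rewrite big_cons; exact: (derivableM (df i) IH).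
Qed.

Lemma derivable_bigsum (I : Type) (r : seq I) (f : I -> V -> R) x v :
  (forall i, derivable (f i) x v) ->
  derivable (fun y => \sum_(i <- r) f i y) x v.
Proof.
move=> df; elim: r => [|i r IH].
  by under eq_fun do rewrite big_nil; exact: derivable_cst.
by under eq_fun do rewrite big_cons; exact: (derivableD (df i) IH).
Qed.

Lemma derivable_det n (A : V -> 'M[R]_n) x v :
  derivable A x v -> derivable (fun y => \det (A y)) x v.
Proof.
move=> dA; apply: derivable_bigsum => s; apply: derivableM.
  exact: derivable_cst.
by apply: derivable_bigprod => i; exact: ((derivable_mxP _ _ _).1 dA).
Qed.

(** The adjugate formula makes the inverse a quotient of polynomials in the entries. It agrees with
    [invmx] where the matrix is invertible, hence the condition on a whole neighbourhood of [x]. *)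
Lemma derivable_invmx n (A : V -> 'M[R]_n) x v :
  derivable A x v -> (\forall y \near x, A y \in unitmx) ->
  derivable (fun y => invmx (A y)) x v.
Proof.
move=> dA Au.
apply: (@near_eq_derivable _ _ _ (fun y => (\det (A y))^-1 *: \adj (A y))).
  by near=> y; rewrite /invmx; have -> : A y \in unitmx by near: y.
apply/(derivable_mxP _ _ _).2 => i j; under eq_fun do rewrite 2!mxE.
apply: derivableM.
  apply: derivableV; last exact: derivable_det.
  by have := nbhs_singleton Au; rewrite unitmxE unitfE.
apply: derivableM; first exact: derivable_cst.
apply: derivable_det; apply/(derivable_mxP _ _ _).2 => k l.
by under eq_fun do rewrite 2!mxE; exact: ((derivable_mxP _ _ _).1 dA).
Unshelve. all: by end_near. Qed.

(** The difference quotients of the restriction to a line and of [f] along [u] are the same function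
    of [h], so one-variable results apply to directional derivatives. *)
Lemma is_derive_line (f : V -> R) (a u : V) t :
  derivable f (t *: u + a) u ->
  is_derive t 1 (fun s : R => f (s *: u + a)) ('D_u f (t *: u + a)).
Proof.
move=> df.
have E : (fun h : R => h^-1 *: (((fun s => f (s *: u + a)) \o shift t) (h *: 1) -
      f (t *: u + a))) =
    (fun h : R => h^-1 *: ((f \o shift (t *: u + a)) (h *: u) -
      f (t *: u + a))).
  by apply/funext => h /=; rewrite [_%:A]mulr1 scalerDl addrA.
by apply: DeriveDef; rewrite /derivable/derive E.
Qed.

(** Two applications of the mean value theorem: first in [s] to the difference [F] along two
    parallel segments, then in [t] to the derivative [G] it produces. *)
Lemma second_difference (f : V -> R) (a u v : V) (h : R) : 0 < h ->
  (forall s t, s \in `[0, h] -> t \in `[0, h] ->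
     derivable f (s *: u + (t *: v + a)) u /\
     derivable ('D_u f) (t *: v + (s *: u + a)) v) ->
  exists s t, [/\ s \in `[0, h], t \in `[0, h] &
    f (h *: u + (h *: v + a)) - f (h *: u + a) - f (h *: v + a) + f a =
    h ^+ 2 * 'D_v ('D_u f) (t *: v + (s *: u + a))].
Proof.
move=> h0 df.
have hin : h \in `[0, h] by rewrite in_itv/= lexx ltW.
have zin : 0 \in `[0, h] by rewrite in_itv/= lexx ltW.
have oc t : t \in `]0, h[ -> t \in `[0, h].
  by rewrite !in_itv/= => /andP[/ltW-> /ltW->].
pose F s := f (s *: u + (h *: v + a)) - f (s *: u + a).
have dF s : s \in `[0, h] -> is_derive s 1 F
    ('D_u f (s *: u + (h *: v + a)) - 'D_u f (s *: u + a)).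
  move=> sh; apply: is_deriveB; apply: is_derive_line.
    by have [] := df _ _ sh hin.
  by have [+ _] := df _ _ sh zin; rewrite scale0r add0r.
have F1 s : s \in `]0, h[ -> is_derive s 1 F
    ('D_u f (s *: u + (h *: v + a)) - 'D_u f (s *: u + a)).
  by move=> /oc; exact: dF.
have F2 : {within `[0, h], continuous F}.
  by apply: derivable_within_continuous => t th; have [] := dF t th.
have [s sh Fs] := MVT h0 F1 F2.
pose G t := 'D_u f (t *: v + (s *: u + a)).
have dG t : t \in `[0, h] ->
    is_derive t 1 G ('D_v ('D_u f) (t *: v + (s *: u + a))).
  by move=> th; apply: is_derive_line; have [_] := df s t (oc _ sh) th.
have G1 t : t \in `]0, h[ ->
    is_derive t 1 G ('D_v ('D_u f) (t *: v + (s *: u + a))).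
  by move=> /oc; exact: dG.
have G2 : {within `[0, h], continuous G}.
  by apply: derivable_within_continuous => t th; have [] := dG t th.
have [t th Gt] := MVT h0 G1 G2.
exists s, t; split; [exact: oc|exact: oc|].
move: Fs Gt; rewrite /F /G !scale0r !add0r subr0 [h *: v + (s *: u + a)]addrCA.
by move=> Fs Gt; rewrite Gt in Fs; rewrite expr2 mulrC mulrA -Fs; ring.
Qed.

Lemma derivable_mulmx m n p (A : V -> 'M[R]_(m, n)) (B : V -> 'M[R]_(n, p)) x v :
  derivable A x v -> derivable B x v -> derivable (fun y => A y *m B y) x v.
Proof.
by move=> /derivableP dA /derivableP dB; have [] := is_derive_mulmx dA dB.
Qed.

Lemma derive_mulmx m n p (A : V -> 'M[R]_(m, n)) (B : V -> 'M[R]_(n, p)) x v :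
  derivable A x v -> derivable B x v ->
  'D_v (fun y => A y *m B y) x = 'D_v A x *m B x + A x *m 'D_v B x.
Proof.
by move=> /derivableP dA /derivableP dB; have [] := is_derive_mulmx dA dB.
Qed.

Lemma derivable_trmx m n (A : V -> 'M[R]_(m, n)) x v :
  derivable A x v -> derivable (fun y => (A y)^T) x v.
Proof. by move=> /derivableP dA; have [] := is_derive_trmx dA. Qed.

Lemma derive_trmx m n (A : V -> 'M[R]_(m, n)) x v :
  derivable A x v -> 'D_v (fun y => (A y)^T) x = ('D_v A x)^T.
Proof. by move=> /derivableP dA; have [] := is_derive_trmx dA. Qed.

Lemma eq_on_derive (W : normedModType R) (U : set V) (f g : V -> W) x v :
  open U -> (forall y, U y -> f y = g y) -> U x -> 'D_v f x = 'D_v g x.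
Proof.
move=> oU fg Ux; apply: near_eq_derive; near=> y; apply: fg; near: y.
exact: open_nbhs_nbhs.
Unshelve. all: by end_near. Qed.

Lemma eq_on_derivable (W : normedModType R) (U : set V) (f g : V -> W) x v :
  open U -> (forall y, U y -> f y = g y) -> U x ->
  derivable f x v -> derivable g x v.
Proof.
move=> oU fg Ux; apply: near_eq_derivable; near=> y; apply: fg; near: y.
exact: open_nbhs_nbhs.
Unshelve. all: by end_near. Qed.

End MatrixDerivatives.

(** * Symmetry of second derivatives *)

Section Schwarz.
Variables (R : realType) (V : normedModType R).

(** The second difference over a small parallelogram is symmetric in [u] and [v], and equals
    [h ^+ 2] times either mixed derivative at some nearby point; continuity of both at [x]
    concludes. *)
Lemma derive_comm (f : V -> R) (x u v : V) :
  (\forall y \near x, [/\ derivable f y u, derivable f y v,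
    derivable ('D_u f) y v & derivable ('D_v f) y u]) ->
  {for x, continuous ('D_v ('D_u f))} -> {for x, continuous ('D_u ('D_v f))} ->
  'D_v ('D_u f) x = 'D_u ('D_v f) x.
Proof.
move=> df cvu cuv; apply/eqP; rewrite -subr_eq0 -normr_le0.
apply/ler_addgt0Pl => e e0; rewrite addr0.
have e20 : 0 < e / 2 by rewrite divr_gt0.
have Pn : \forall y \near x, `|'D_v ('D_u f) x - 'D_v ('D_u f) y| < e / 2.
  by move/cvgrPdist_lt: cvu; apply.
have Qn : \forall y \near x, `|'D_u ('D_v f) x - 'D_u ('D_v f) y| < e / 2.
  by move/cvgrPdist_lt: cuv; apply.
have dPQ := filterI df (filterI Pn Qn).
have [r /= r0 rx] := (nbhs_ballP _ _).1 (dPQ _ _).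
(* Since [h * c] is half of [r], the parallelogram spanned by [h *: u] and [h *: v] stays in the
   ball; the summand 1 keeps [c] positive even when [u] and [v] vanish. *)
pose c : R := 1 + `|u| + `|v|.
have c0 : 0 < c by rewrite ltr_wpDr// ltr_wpDr.
pose h := r / 2 / c.
have h0 : 0 < h by rewrite !divr_gt0.
have small s t : s \in `[0, h] -> t \in `[0, h] ->
    ball x r (s *: u + (t *: v + x)).
  rewrite !in_itv/= => /andP[s0 sh] /andP[t0 th].
  rewrite -ball_normE/= addrA opprD addrCA subrr addr0 normrN.
  apply: (le_lt_trans (ler_normD _ _)).
  rewrite !normrZ (ger0_norm s0) (ger0_norm t0).
  apply: (@le_lt_trans _ _ (h * c)).
    rewrite /c !mulrDr mulr1 -addrA.
    by rewrite ler_wpDl ?(ltW h0)// lerD// ler_wpM2r.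
  by rewrite /h divfK ?gt_eqF// ltr_pdivrMr// ltr_pMr// ltr1n.
(* [small] writes points with [u] first; the casts by [addrCA] reorder the summands where [v] must
   come first. *)
have [s [t [sh th E1]]] := @second_difference _ _ f x u v h h0 (fun s t sh th =>
  let: conj (And4 a _ b _) _ := rx _ (small s t sh th) in
  conj a (eq_ind _ (fun y => derivable ('D_u f) y v) b _ (addrCA _ _ _))).
have [s' [t' [sh' th' E2]]] := @second_difference _ _ f x v u h h0 (fun s t sh th =>
  let: conj (And4 _ a _ b) _ := rx _ (small t s th sh) in
  conj (eq_ind _ (fun y => derivable f y v) a _ (addrCA _ _ _)) b).
have [_ [+ _]] := rx _ (small _ _ sh th).
have [_ [_ +]] := rx _ (small _ _ th' sh').
rewrite (addrCA (s *: u)).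
(* Both sides are one second difference divided by [h ^+ 2], so a single value lies within [e / 2]
   of both mixed derivatives at [x]. *)
have -> : 'D_v ('D_u f) (t *: v + (s *: u + x)) =
    'D_u ('D_v f) (t' *: u + (s' *: v + x)).
  apply: (@mulfI _ (h ^+ 2)); first by rewrite expf_neq0// gt_eqF.
  apply: (etrans (esym E1)); apply: etrans E2.
  by rewrite (addrCA (h *: v)); congr (_ + _); exact: addrAC.
move: ('D_v ('D_u f) x) ('D_u ('D_v f) x) ('D_u ('D_v f) (_ + _)) => a b w hb ha.
rewrite -(subrKA w) (le_trans (ler_normD _ _))// [e]splitr ltW// ltrD//.
by rewrite distrC.
Qed.

End Schwarz.

(** * Smooth matrix-valued functions on an open set *)

Section Smooth.
Variables (R : realType) (d : nat) (U : set 'rV[R]_d).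
Hypothesis openU : open U.
Local Notation V := 'rV[R]_d.
Local Notation "''e_' i" := (delta_mx 0 i : V) (at level 8, i at level 2).

Lemma smooth_on_cst (c : R) : smooth_on U (fun=> c).
Proof.
move=> s x Ux; have [c' ->] : exists c', foldr (@partial R d) (fun=> c) s = cst c'.
  elim: s => [|i s [c' /= ->]]; first by exists c.
  by exists 0; apply/funext => y; exact: derive_cst.
by split=> [|i]; [exact: cst_continuous|exact: derivable_cst].
Qed.

Lemma smooth_mx_on_cst m n (C : 'M[R]_(m, n)) : smooth_mx_on U (fun=> C).
Proof. by move=> i j; exact: smooth_on_cst. Qed.

Variables (m n : nat) (A : V -> 'M[R]_(m, n)).
Hypothesis smA : smooth_mx_on U A.

Lemma smooth_mx_derivable x i : U x -> derivable A x 'e_i.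
Proof.
move=> Ux; apply/(derivable_mxP _ _ _).2 => a b.
by have [_] := smA a b [::] Ux; apply.
Qed.

Lemma partial_entry x i a b : U x ->
  'D_('e_i) A x a b = partial i (fun y => A y a b) x.
Proof. by move=> Ux; rewrite derive_mx ?mxE//; exact: smooth_mx_derivable. Qed.

Lemma smooth_mx_derivable2 x i j : U x -> derivable ('D_('e_i) A) x 'e_j.
Proof.
move=> Ux; apply/(derivable_mxP _ _ _).2 => a b.
apply: (@eq_on_derivable _ _ _ U (partial i (fun y => A y a b))) => //.
  by move=> y Uy; rewrite partial_entry.
by have [_] := smA a b [:: i] Ux; apply.
Qed.

Lemma smooth_mx_derive_comm x i j : U x ->
  'D_('e_j) ('D_('e_i) A) x = 'D_('e_i) ('D_('e_j) A) x.
Proof.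
move=> Ux; apply/matrixP => a b.
have E k l : 'D_('e_l) ('D_('e_k) A) x a b =
    partial l (partial k (fun y => A y a b)) x.
  rewrite derive_mx; last exact: smooth_mx_derivable2.
  rewrite mxE; apply: (eq_on_derive _ openU) => // y Uy.
  by rewrite partial_entry.
transitivity (partial j (partial i (fun y => A y a b)) x); first exact: E.
transitivity (partial i (partial j (fun y => A y a b)) x); last exact/esym/E.
apply: (@derive_comm _ _ (fun y => A y a b)).
- near=> y; have Uy : U y by near: y; exact: open_nbhs_nbhs.
  have [_ d0] := smA a b [::] Uy; have [_ di] := smA a b [:: i] Uy.
  by have [_ dj] := smA a b [:: j] Uy; split;
    [exact: d0|exact: d0|exact: di|exact: dj].
- by have [+ _] := smA a b [:: j; i] Ux.
- by have [+ _] := smA a b [:: i; j] Ux.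
Unshelve. all: by end_near. Qed.

End Smooth.

(* Linear arithmetic on matrices, treating the products as atoms. *)
Ltac mxatoms :=
  repeat match goal with |- context [@mulmx ?R ?m ?n ?p ?A ?B] =>
    let X := fresh "X" in move: (@mulmx R m n p A B) => X end.
Ltac mxring := mxatoms; apply/matrixP => ? ?; rewrite !mxE; ring.
Ltac mxlra := mxatoms;
  let h := fresh "h" in let a := fresh "a" in let b := fresh "b" in
  move=> /matrixP h; apply/matrixP => a b; move: (h a b); rewrite !mxE; lra.

(* Locked, since unification would otherwise unfold limits of quotients. *)
HB.lock Definition pd (R : realType) (d m n : nat) (i : 'I_d)
    (A : 'rV[R]_d -> 'M[R]_(m, n)) : 'rV[R]_d -> 'M[R]_(m, n) :=
  'D_(delta_mx 0 i) A.

(** * Rules for coordinate partial derivatives *)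

Section PartialDerivatives.
Variables (R : realType) (d : nat).
Local Notation V := 'rV[R]_d.
Local Notation "''e_' i" := (delta_mx 0 i : V) (at level 8, i at level 2).

Lemma pdE m n i (A : V -> 'M[R]_(m, n)) : pd i A = 'D_('e_i) A.
Proof. by rewrite pd.unlock. Qed.

Definition derivable_all m n (A : V -> 'M[R]_(m, n)) x : Prop :=
  forall i, derivable A x 'e_i.

(* Linear in u, which 'D_u A x is only known to be when A is differentiable. *)
Definition total_pd m n (A : V -> 'M[R]_(m, n)) (x u : V) : 'M[R]_(m, n) :=
  \sum_i u 0 i *: pd i A x.

Section Rules.
Variables (m n p : nat).
Implicit Types (A B : V -> 'M[R]_(m, n)) (C : V -> 'M[R]_(n, p)).

Lemma pd_cst (M : 'M[R]_(m, n)) i (x : V) : pd i (fun _ : V => M) x = 0.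
Proof. by rewrite pdE; exact: derive_cst. Qed.

Lemma derivable_all_cst (M : 'M[R]_(m, n)) x : derivable_all (fun=> M) x.
Proof. by move=> i; exact: derivable_cst. Qed.

Lemma pdD A B i x : derivable_all A x -> derivable_all B x ->
  pd i (fun y => A y + B y) x = pd i A x + pd i B x.
Proof. by move=> dA dB; rewrite !pdE; exact: deriveD. Qed.

Lemma derivable_allD A B x : derivable_all A x -> derivable_all B x ->
  derivable_all (fun y => A y + B y) x.
Proof. by move=> dA dB i; exact: derivableD. Qed.

Lemma pdN A i x : derivable_all A x -> pd i (fun y => - A y) x = - pd i A x.
Proof. by move=> dA; rewrite !pdE; exact: deriveN. Qed.

Lemma derivable_allN A x : derivable_all A x -> derivable_all (fun y => - A y) x.
Proof. by move=> dA i; exact: derivableN. Qed.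

Lemma pdM A C i x : derivable_all A x -> derivable_all C x ->
  pd i (fun y => A y *m C y) x = pd i A x *m C x + A x *m pd i C x.
Proof. by move=> dA dC; rewrite !pdE; exact: derive_mulmx. Qed.

Lemma derivable_allM A C x : derivable_all A x -> derivable_all C x ->
  derivable_all (fun y => A y *m C y) x.
Proof. by move=> dA dC i; exact: derivable_mulmx. Qed.

Lemma pdT A i x : derivable_all A x -> pd i (fun y => (A y)^T) x = (pd i A x)^T.
Proof. by move=> dA; rewrite !pdE; exact: derive_trmx. Qed.

Lemma derivable_allT A x : derivable_all A x -> derivable_all (fun y => (A y)^T) x.
Proof. by move=> dA i; exact: derivable_trmx. Qed.

Lemma pd_entry A i x a b : derivable_all A x ->
  pd i A x a b = partial i (fun y => A y a b) x.
Proof. by move=> dA; rewrite pdE derive_mx ?mxE. Qed.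

End Rules.

Lemma derivable_all_sum m n (I : Type) (r : seq I)
    (F : I -> V -> 'M[R]_(m, n)) x :
  (forall k, derivable_all (F k) x) ->
  derivable_all (fun y => \sum_(k <- r) F k y) x.
Proof.
move=> dF; elim: r => [|k r IH].
  have -> : (fun y => \sum_(k <- [::]) F k y) = (fun=> 0).
    by apply/funext => y; rewrite big_nil.
  exact: derivable_all_cst.
have -> : (fun y => \sum_(j <- k :: r) F j y) =
    (fun y => F k y + \sum_(j <- r) F j y).
  by apply/funext => y; rewrite big_cons.
exact: (derivable_allD (dF k) IH).
Qed.

Lemma pd_sum m n (I : Type) (r : seq I) (F : I -> V -> 'M[R]_(m, n)) i x :
  (forall k, derivable_all (F k) x) ->
  pd i (fun y => \sum_(k <- r) F k y) x = \sum_(k <- r) pd i (F k) x.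
Proof.
move=> dF; elim: r => [|k r IH].
  have -> : (fun y => \sum_(k <- [::]) F k y) = (fun=> 0).
    by apply/funext => y; rewrite big_nil.
  by rewrite big_nil; exact: pd_cst.
have -> : (fun y => \sum_(j <- k :: r) F j y) =
    (fun y => F k y + \sum_(j <- r) F j y).
  by apply/funext => y; rewrite big_cons.
rewrite big_cons -IH; exact: (pdD i (dF k) (derivable_all_sum dF)).
Qed.

Lemma derivable_all_scale m n (f : V -> R) (A : V -> 'M[R]_(m, n)) x :
  (forall i, derivable f x 'e_i) -> derivable_all A x ->
  derivable_all (fun y => f y *: A y) x.
Proof.
move=> df dA k; apply/(derivable_mxP _ _ _).2 => a b.
under eq_fun do rewrite mxE.
exact: (derivableM (df k) ((derivable_mxP _ _ _).1 (dA k) a b)).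
Qed.

Lemma pd_scale m n (f : V -> R) (A : V -> 'M[R]_(m, n)) i x :
  (forall i, derivable f x 'e_i) -> derivable_all A x ->
  pd i (fun y => f y *: A y) x = partial i f x *: A x + f x *: pd i A x.
Proof.
move=> df dA; have dfA := derivable_all_scale df dA.
apply/matrixP => a b; rewrite pd_entry// !mxE pd_entry//.
rewrite (_ : (fun y => _) = f * (fun y => A y a b)); last first.
  by apply/funext => y; rewrite mxE.
rewrite {1}/partial deriveM//; last exact: ((derivable_mxP _ _ _).1 (dA i)).
by rewrite addrC; congr (_ + _); exact: mulrC.
Qed.

Section OnOpen.
Variable (U : set V).
Hypothesis openU : open U.

Lemma eq_on_pd m n (A B : V -> 'M[R]_(m, n)) i x :
  (forall y, U y -> A y = B y) -> U x -> pd i A x = pd i B x.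
Proof. by move=> AB Ux; rewrite !pdE; exact: (eq_on_derive _ openU). Qed.

Lemma smooth_derivable_all m n (A : V -> 'M[R]_(m, n)) x :
  smooth_mx_on U A -> U x -> derivable_all A x.
Proof. by move=> sA Ux i; exact: (smooth_mx_derivable sA). Qed.

Lemma smooth_derivable_pd m n (A : V -> 'M[R]_(m, n)) i x :
  smooth_mx_on U A -> U x -> derivable_all (pd i A) x.
Proof. by move=> sA Ux j; rewrite pdE; exact: (smooth_mx_derivable2 openU sA). Qed.

Lemma smooth_pd_comm m n (A : V -> 'M[R]_(m, n)) i j x :
  smooth_mx_on U A -> U x -> pd i (pd j A) x = pd j (pd i A) x.
Proof. by move=> sA Ux; rewrite !pdE; exact: (smooth_mx_derive_comm openU sA). Qed.

(* Schwarz applied to the first-order system d_i A = P_i A + A Q_i. *)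
Lemma integrability m n (A : V -> 'M[R]_(m, n)) (P : 'I_d -> V -> 'M[R]_m)
    (Q : 'I_d -> V -> 'M[R]_n) x i j :
  smooth_mx_on U A -> U x ->
  (forall i, derivable_all (P i) x) -> (forall i, derivable_all (Q i) x) ->
  (forall i y, U y -> pd i A y = P i y *m A y + A y *m Q i y) ->
  (pd i (P j) x - pd j (P i) x + P j x *m P i x - P i x *m P j x) *m A x =
  A x *m (pd j (Q i) x - pd i (Q j) x + Q j x *m Q i x - Q i x *m Q j x).
Proof.
move=> sA Ux dP dQ eqA; have dA := smooth_derivable_all sA Ux.
have E k l : pd l (pd k A) x =
    pd l (P k) x *m A x + P k x *m (P l x *m A x + A x *m Q l x) +
    ((P l x *m A x + A x *m Q l x) *m Q k x + A x *m pd l (Q k) x).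
  rewrite (eq_on_pd l (eqA k) Ux) pdD; [|exact: derivable_allM..].
  by rewrite !pdM// !eqA.
(* The mixed terms, with [P] on one side of [A] and [Q] on the other, are symmetric in the two
   indices and cancel. *)
have := smooth_pd_comm i j sA Ux; rewrite !E.
rewrite !(mulmxDl, mulmxDr, mulmxBl, mulmxBr, mulmxA, mulNmx, mulmxN).
mxlra.
Qed.

End OnOpen.
End PartialDerivatives.

(** * Pointwise algebra *)

Section NormalClosedForm.
Variables (R : realFieldType) (V : lmodType R).
Variables (phi : V -> V) (eta : V -> R) (xi : V) (A : V -> V -> V -> R).
Hypothesis phi2 : forall v, phi (phi v) = - v + eta v *: xi.
Hypothesis A_add1 : forall u v y z, A (u + v) y z = A u y z + A v y z.
Hypothesis A_scale1 : forall a u y z, A (a *: u) y z = a * A u y z.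
Hypothesis A_add2 : forall x u v z, A x (u + v) z = A x u z + A x v z.
Hypothesis A_scale2 : forall a x u z, A x (a *: u) z = a * A x u z.
Hypothesis A_skew : forall x y z, A x y z = - A x z y.
Hypothesis A_cyclic : forall x y z, A x y z + A y z x + A z x y = 0.
Hypothesis A_normal : forall x y z,
  A (phi x) y z - A (phi y) x z - A y x (phi z) + A x y (phi z) = 0.
Hypothesis A_xi : forall z, A xi xi z = 0.

(* With a = A (phi x) y z, b = A (phi y) z x and c = A (phi z) x y, closedness
   turns A_normal into a + b = c, whose cyclic shift is c + a = b. *)
Lemma closed_normal_phi x y z : A (phi x) y z = 0.
Proof.
have key u v w : A (phi u) v w + A (phi v) w u - A (phi w) u v = 0.
  have := A_normal u v w; have := A_cyclic u v (phi w).
  by rewrite (A_skew (phi v) u w) (A_skew v u (phi w)); lra.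
by have := key z x y; have := key x y z; lra.
Qed.

(** Splitting the first argument as [- phi (phi v) + eta v *: xi] leaves only [A xi], by
    [closed_normal_phi]. Splitting the second one too, the [xi] part falls to [A_xi], and the cyclic
    identity trades the other part for two vanishing terms. *)
Lemma closed_normal_vanish x y z : A x y z = 0.
Proof.
have dec v : v = (-1) *: phi (phi v) + eta v *: xi.
  by rewrite phi2 scaleN1r opprD opprK subrK.
have dec1 u v w : A u v w = eta u * A xi v w.
  by rewrite [u in LHS]dec A_add1 !A_scale1 closed_normal_phi mulr0 add0r.
rewrite dec1 [y in LHS]dec A_add2 !A_scale2 A_xi mulr0 addr0.
have := A_cyclic xi (phi (phi y)) z.
rewrite closed_normal_phi (dec1 z) A_xi mulr0 !addr0 => ->.
by rewrite !mulr0.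
Qed.

End NormalClosedForm.

(* [Om i j] is the curvature endomorphism R(e_i, e_j), acting on row vectors. *)
Section RicciTrace.
Variables (R : realFieldType) (d : nat) (Om : 'I_d -> 'I_d -> 'M[R]_d).
Hypothesis Om_anti : forall i j, Om j i = - Om i j.
Hypothesis Om_bianchi : forall i j k l,
  Om i j k l + Om j k i l + Om k i j l = 0.

Definition ricci_mx : 'M[R]_d := \matrix_(j, k) \sum_i Om i j k i.

(** Commuting [phi] past [Om] writes the entries as double sums; by Bianchi, two transposed entries
    then differ by a trace of [Om j k *m phi], which is zero. *)
Lemma ricci_mx_comm_sym (phi : 'M[R]_d) :
  (forall i j, Om i j *m phi = phi *m Om i j) ->
  (forall i j, \tr (Om i j *m phi) = 0) ->
  (ricci_mx *m phi^T)^T = ricci_mx *m phi^T.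
Proof.
move=> com tr0.
have E j k : (ricci_mx *m phi^T) j k =
    \sum_i \sum_l Om i j k l * phi l i.
  rewrite mxE.
  transitivity (\sum_i (phi *m Om i j) k i); last first.
    by apply: eq_bigr => i _; rewrite -com mxE.
  under eq_bigr do rewrite !mxE mulr_suml.
  rewrite exchange_big/=; apply: eq_bigr => i _; rewrite mxE.
  by apply: eq_bigr => l _; rewrite mulrC.
apply/matrixP => k j; rewrite mxE !E; apply/eqP; rewrite -subr_eq0; apply/eqP.
transitivity (- \tr (Om j k *m phi)); last by rewrite tr0 oppr0.
rewrite /mxtrace -sumrB -sumrN; apply: eq_bigr => i _.
rewrite mxE -sumrB -sumrN; apply: eq_bigr => l _.
have := Om_bianchi i j k l; rewrite (Om_anti i k) mxE => h.
apply/eqP; rewrite -subr_eq0; apply/eqP.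
transitivity ((Om i j k l + Om j k i l - Om i k j l) * phi l i); first by ring.
by rewrite h mul0r.
Qed.

Lemma ricci_mx_sym :
  (forall i j, \tr (Om i j) = 0) -> ricci_mx^T = ricci_mx.
Proof.
move=> tr0; have := @ricci_mx_comm_sym 1%:M; rewrite trmx1 mulmx1; apply.
  by move=> i j; rewrite mulmx1 mul1mx.
by move=> i j; rewrite mulmx1.
Qed.

Lemma ricci_mx_ker (xi : 'rV[R]_d) :
  (forall i j, xi *m Om i j = 0) -> ricci_mx *m xi^T = 0.
Proof.
move=> xi0; apply/matrixP => j o; rewrite !mxE.
transitivity (\sum_i (xi *m Om i j) o i); last first.
  by rewrite big1// => i _; rewrite xi0 mxE.
under eq_bigr do rewrite !mxE mulr_suml.
rewrite exchange_big/=; apply: eq_bigr => i _; rewrite mxE.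
by apply: eq_bigr => l _; rewrite mulrC.
Qed.

End RicciTrace.

(** The rank one terms have zero trace against [K], which kills [xia] and [xib]. Cyclicity of the
    trace, with [K] commuting past [phia], identifies the traces coming from the two products, which
    are also opposite. *)
Lemma trace_product_commutator (R : realFieldType) d (K phia phib phic : 'M[R]_d)
    (xia xib : 'rV[R]_d) (etaa etab : 'cV[R]_d) :
  K *m phia = phia *m K -> xia *m K = 0 -> xib *m K = 0 ->
  phib *m phia - etab *m xia = phic -> phia *m phib - etaa *m xib = - phic ->
  \tr (K *m phic) = 0.
Proof.
move=> com xa xb Eba Eab.
have tr_rank1 (e : 'cV[R]_d) (x : 'rV[R]_d) : x *m K = 0 ->
    \tr (K *m (e *m x)) = 0.
  by move=> xK; rewrite mxtrace_mulC -mulmxA xK mulmx0 mxtrace0.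
have E1 : \tr (K *m phic) = \tr (K *m phib *m phia).
  by rewrite -Eba mulmxBr raddfB/= tr_rank1// subr0 mulmxA.
have E2 : - \tr (K *m phic) = \tr (K *m phib *m phia).
  rewrite -raddfN/= -mulmxN -Eab mulmxBr raddfB/= tr_rank1// subr0.
  by rewrite mulmxA com mxtrace_mulC mulmxA mxtrace_mulC mulmxA.
by move: E1 E2; lra.
Qed.

(* Moving phib and phia across Rc one after the other reverses their order, so
   Rc would commute with phic up to both signs. *)
Lemma sym_commuting_quaternion0 (R : realFieldType) d
    (Rc phia phib phic : 'M[R]_d)
    (xia xib xic : 'rV[R]_d) (etaa etab etac : 'cV[R]_d) :
  Rc^T = Rc ->
  Rc *m phia^T = phia *m Rc -> Rc *m phib^T = phib *m Rc ->
  Rc *m phic^T = phic *m Rc ->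
  Rc *m xia^T = 0 -> Rc *m xib^T = 0 -> Rc *m xic^T = 0 ->
  phib *m phia - etab *m xia = phic -> phia *m phib - etaa *m xib = - phic ->
  phic *m phic = - 1%:M + etac *m xic ->
  Rc = 0.
Proof.
move=> Rsym ca cb cc xa xb xc Eba Eab Ecc.
have xbR : xib *m Rc = 0 by apply: trmx_inj; rewrite trmx_mul Rsym xb trmx0.
have E1 : Rc *m phic^T = phia *m phib *m Rc.
  rewrite -Eba raddfB/= !trmx_mul mulmxBr !mulmxA xa mul0mx subr0.
  by rewrite ca -!mulmxA cb.
have E2 : Rc *m phic^T = - (phia *m phib *m Rc).
  rewrite cc -[phic]opprK -Eab mulNmx mulmxBl -[_ *m xib *m _]mulmxA xbR.
  by rewrite mulmx0 subr0.
have E : Rc *m phic^T = 0.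
  apply/matrixP => i j; move: E2; rewrite -E1 => /matrixP/(_ i j).
  by rewrite !mxE => e; lra.
(* [phic] squares to minus the identity up to a rank one term whose transpose [Rc] kills, so one
   more factor [phic^T] recovers [- Rc]. *)
have := congr1 (mulmx^~ phic^T) E; rewrite /= mul0mx -mulmxA -trmx_mul Ecc.
rewrite raddfD/= raddfN/= trmx1 trmx_mul mulmxDr mulmxA xc mul0mx addr0.
by rewrite mulmxN mulmx1 => /eqP; rewrite oppr_eq0 => /eqP.
Qed.

(** * The Levi-Civita connection in a chart *)

(** Row [j] holds the components of nabla_i e_j. *)
HB.lock Definition connection_mx (R : realType) (d : nat)
    (g : 'rV[R]_d -> 'M[R]_d) (i : 'I_d) (x : 'rV[R]_d) : 'M[R]_d :=
  \matrix_(j, k) christoffel g k i j x.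

Section LeviCivita.
Variables (R : realType) (d : nat).
Local Notation V := 'rV[R]_d.
Variables (U : set V) (g : V -> 'M[R]_d).
Hypothesis openU : open U.
Hypothesis smg : smooth_mx_on U g.
Hypothesis g_sym : forall y, U y -> (g y)^T = g y.
Hypothesis g_unit : forall y, U y -> g y \in unitmx.

Local Notation Gam := (connection_mx g).

(** Endomorphisms multiply rows on the right, so the quadratic terms of [nabla_i, nabla_j] appear in
    reversed order. *)
Definition curvature_mx (i j : 'I_d) (x : V) : 'M[R]_d :=
  pd i (Gam j) x - pd j (Gam i) x + Gam j x *m Gam i x - Gam i x *m Gam j x.

Let dg x : U x -> derivable_all g x.
Proof. exact: smooth_derivable_all. Qed.

Lemma pd_metric_sym i j k x : U x -> pd i g x j k = pd i g x k j.
Proof.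
move=> Ux; have := eq_on_pd openU i g_sym Ux; rewrite pdT; last exact: dg.
by move=> /matrixP/(_ k j); rewrite mxE.
Qed.

(** Multiplying by [g] cancels the inverse metric and leaves the Christoffel symbols of the first
    kind. *)
Lemma connection_metric i x : U x -> Gam i x *m g x =
  \matrix_(j, l) (2^-1 * (pd i g x j l + pd j g x i l - pd l g x i j)).
Proof.
move=> Ux; have dgx := dg Ux.
have -> : Gam i x =
    (\matrix_(j, l) (2^-1 * (pd i g x j l + pd j g x i l - pd l g x i j)))
    *m (invmx (g x))^T.
  apply/matrixP => j k; rewrite connection_mx.unlock !mxE /christoffel mulr_sumr.
  apply: eq_bigr => l _; rewrite !mxE !(pd_entry _ _ _ dgx) mulrA.
  by rewrite [in RHS]mulrAC (mulrC 2^-1).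
rewrite -mulmxA -{2}(g_sym Ux) -trmx_mul mulmxV ?g_unit// trmx1 mulmx1.
by [].
Qed.

(** Adding the first-kind symbols to their transpose cancels the terms skew in [j] and [k]. *)
Lemma metric_parallel i x : U x ->
  pd i g x = Gam i x *m g x + g x *m (Gam i x)^T.
Proof.
move=> Ux; rewrite -{2}(g_sym Ux) -trmx_mul connection_metric//.
apply/matrixP => j k; rewrite !mxE (pd_metric_sym i k j Ux); lra.
Qed.

Lemma connection_torsion_free i j k x : U x -> Gam i x j k = Gam j x i k.
Proof.
move=> Ux; have dgx := dg Ux.
rewrite connection_mx.unlock !mxE /christoffel; congr (_ * _).
apply: eq_bigr => l _; congr (_ * _); rewrite -!pd_entry//.
by rewrite (pd_metric_sym l j i Ux) [pd i g x j l + _]addrC.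
Qed.

Lemma connection_derivable i x : U x -> derivable_all (Gam i) x.
Proof.
move=> Ux m; apply/(derivable_mxP _ _ _).2 => j k.
rewrite connection_mx.unlock; under eq_fun do rewrite mxE.
have dinv : derivable (fun y => invmx (g y)) x (delta_mx 0 m).
  apply: derivable_invmx; first exact: dg.
  near=> y; apply: g_unit; near: y; exact: open_nbhs_nbhs.
have dpart a b c : derivable (partial a (fun y => g y b c)) x (delta_mx 0 m).
  by have [_] := smg b c [:: a] Ux; apply.
apply: derivableM; first exact: derivable_cst.
apply: derivable_bigsum => l; apply: derivableM.
  exact: ((derivable_mxP _ _ _).1 dinv).
by apply: derivableB; [apply: derivableD|]; exact: dpart.
Unshelve. all: by end_near. Qed.

Lemma pd_connection_torsion_free m i j k x : U x ->
  pd m (Gam i) x j k = pd m (Gam j) x i k.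
Proof.
move=> Ux; rewrite !pd_entry; try exact: connection_derivable.
apply: (eq_on_derive _ openU) => // y Uy.
exact: connection_torsion_free.
Qed.

Lemma curvature_anti i j x : curvature_mx j i x = - curvature_mx i j x.
Proof. by rewrite /curvature_mx; mxring. Qed.

(** Torsion-freeness cancels everything: derivatives of the symbols pair off by symmetry in the
    lower indices, and the quadratic terms [P] are symmetric in their first two arguments. *)
Lemma curvature_bianchi i j k l x : U x ->
  curvature_mx i j x k l + curvature_mx j k x i l + curvature_mx k i x j l = 0.
Proof.
move=> Ux; have T m a b c := pd_connection_torsion_free m a b c Ux.
pose P a b c := \sum_m Gam a x b m * Gam c x m l.
have E a b c : curvature_mx a b x c l =
    pd a (Gam b) x c l - pd b (Gam a) x c l + P b c a - P a c b.
  by rewrite /curvature_mx !mxE.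
have Ps a b c : P a b c = P b a c.
  by apply: eq_bigr => m _; rewrite (connection_torsion_free a b m Ux).
rewrite !E (T i j k l) (T j k i l) (T k i j l).
rewrite (Ps j k i) (Ps k i j) (Ps i j k).
ring.
Qed.

(** Integrability condition of nabla g = 0, with the transposed connection matrices acting on the
    right. *)
Lemma curvature_metric i j x : U x ->
  curvature_mx i j x *m g x = - (g x *m (curvature_mx i j x)^T).
Proof.
move=> Ux.
have dG k : derivable_all (Gam k) x by exact: connection_derivable.
have := integrability openU (Q := fun i y => (Gam i y)^T) i j smg Ux dG
  (fun k => derivable_allT (dG k)) metric_parallel.
rewrite -/(curvature_mx i j x) => ->.
rewrite -[RHS]mulmxN; congr (_ *m _); rewrite /curvature_mx !pdT//.
rewrite -!trmx_mul /curvature_mx.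
by mxring.
Qed.

(** Skewness makes the curvature conjugate by [g] to minus its transpose, so its trace is its own
    negative. *)
Lemma curvature_trace i j x : U x -> \tr (curvature_mx i j x) = 0.
Proof.
move=> Ux; have gU := g_unit Ux.
have E : curvature_mx i j x =
    - (g x *m (curvature_mx i j x)^T *m invmx (g x)).
  by rewrite -mulNmx -curvature_metric// mulmxK.
have : \tr (curvature_mx i j x) = - \tr (curvature_mx i j x).
  rewrite {1}E raddfN/= mxtrace_mulC mulmxA mulVmx// mul1mx mxtrace_tr.
  by [].
lra.
Qed.

(** Integrability condition of nabla phi = 0, the right coefficients being minus the connection
    matrices. *)
Lemma curvature_comm (phi : V -> 'M[R]_d) i j x :
  smooth_mx_on U phi ->
  (forall i y, U y -> pd i phi y = Gam i y *m phi y - phi y *m Gam i y) ->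
  U x -> curvature_mx i j x *m phi x = phi x *m curvature_mx i j x.
Proof.
move=> sphi par Ux.
have dG k : derivable_all (Gam k) x by exact: connection_derivable.
have := integrability openU (Q := fun i y => - Gam i y) i j sphi Ux dG
  (fun k => derivable_allN (dG k)).
rewrite -/(curvature_mx i j x) => ->; last first.
  by move=> k y Uy; rewrite par// mulmxN.
congr (_ *m _); rewrite /curvature_mx !pdN// !mulmxN !mulNmx !opprK.
by mxring.
Qed.

End LeviCivita.

(** * Derivatives along a tangent vector *)

Section TotalDerivative.
Variables (R : realType) (d : nat) (U : set 'rV[R]_d).
Hypothesis openU : open U.
Local Notation V := 'rV[R]_d.
Implicit Types (x u v : V).

Lemma total_pdD m n (A : V -> 'M[R]_(m, n)) x u v :
  total_pd A x (u + v) = total_pd A x u + total_pd A x v.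
Proof.
by rewrite -big_split; apply: eq_bigr => i _; rewrite mxE scalerDl.
Qed.

Lemma total_pdZ m n (A : V -> 'M[R]_(m, n)) x a u :
  total_pd A x (a *: u) = a *: total_pd A x u.
Proof.
by rewrite scaler_sumr; apply: eq_bigr => i _; rewrite mxE scalerA.
Qed.

Lemma total_pd_delta m n (A : V -> 'M[R]_(m, n)) x i :
  total_pd A x (delta_mx 0 i) = pd i A x.
Proof.
rewrite /total_pd (bigD1 i)//= big1 ?addr0 => [|j ji].
  by rewrite mxE !eqxx scale1r.
by rewrite mxE eqxx (negbTE ji) scale0r.
Qed.

Lemma total_pd_cst m n (M : 'M[R]_(m, n)) x u : total_pd (fun=> M) x u = 0.
Proof. by rewrite /total_pd big1// => i _; rewrite pd_cst scaler0. Qed.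

Lemma total_pdM m n p (A : V -> 'M[R]_(m, n)) (B : V -> 'M[R]_(n, p)) x u :
  derivable_all A x -> derivable_all B x ->
  total_pd (fun y => A y *m B y) x u =
  total_pd A x u *m B x + A x *m total_pd B x u.
Proof.
move=> dA dB; rewrite /total_pd mulmx_suml mulmx_sumr -big_split.
apply: eq_bigr => i _; rewrite (pdM i dA dB) scalerDr.
by rewrite scalemxAl scalemxAr.
Qed.

Lemma total_pdT m n (A : V -> 'M[R]_(m, n)) x u : derivable_all A x ->
  total_pd (fun y => (A y)^T) x u = (total_pd A x u)^T.
Proof.
move=> dA; rewrite /total_pd raddf_sum; apply: eq_bigr => i _.
by rewrite (pdT i dA) -linearZ.
Qed.

Lemma total_pdN m n (A : V -> 'M[R]_(m, n)) x u : derivable_all A x ->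
  total_pd (fun y => - A y) x u = - total_pd A x u.
Proof.
move=> dA; rewrite /total_pd -sumrN; apply: eq_bigr => i _.
by rewrite (pdN i dA) scalerN.
Qed.

Lemma eq_on_total_pd m n (A B : V -> 'M[R]_(m, n)) x u :
  (forall y, U y -> A y = B y) -> U x -> total_pd A x u = total_pd B x u.
Proof.
by move=> AB Ux; apply: eq_bigr => i _; rewrite (eq_on_pd openU i AB Ux).
Qed.

End TotalDerivative.

(** Pairings are kept as 1 x 1 matrices; transposing one exchanges its two arguments. *)
Lemma tr_mx11 (R : nzRingType) (M : 'M[R]_1) : M^T = M.
Proof. by apply/matrixP => i j; rewrite mxE !ord1. Qed.

(** * Parallelism of phi for a single structure *)

Section AlmostContactParallel.
Variables (R : realType) (d : nat).
Local Notation V := 'rV[R]_d.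
Variables (U : set V) (g phi : V -> 'M[R]_d) (xi : V -> V) (eta : V -> 'cV[R]_d).
Hypothesis openU : open U.
Hypotheses (smg : smooth_mx_on U g) (smphi : smooth_mx_on U phi).
Hypotheses (smxi : smooth_mx_on U xi) (smeta : smooth_mx_on U eta).
Hypothesis g_sym : forall y, U y -> (g y)^T = g y.
Hypothesis g_unit : forall y, U y -> g y \in unitmx.
Hypothesis phi2 : forall y, U y -> phi y *m phi y = - 1%:M + eta y *m xi y.
Hypothesis phi_skew : forall y, U y -> g y *m (phi y)^T = - (phi y *m g y).
Hypothesis xi_phi : forall y, U y -> xi y *m phi y = 0.
Hypothesis eta_def : forall y, U y -> eta y = g y *m (xi y)^T.
Hypothesis xi_eta : forall y, U y -> xi y *m eta y = 1%:M.
Variable x : V.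
Hypothesis Ux : U x.
(** The closedness and normality conditions as they read on constant coordinate fields. *)
Hypothesis eta_closed : forall v w,
  w *m total_pd eta x v = v *m total_pd eta x w.
Local Notation DP := (total_pd (fun y => g y *m (phi y)^T) x).
Hypothesis Phi_closed : forall u v w,
  v *m DP u *m w^T + w *m DP v *m u^T + u *m DP w *m v^T = 0.
Local Notation Dphi := (total_pd phi x).
Hypothesis phi_normal : forall v w,
  w *m Dphi (v *m phi x) - v *m Dphi (w *m phi x)
  + v *m Dphi w *m phi x - w *m Dphi v *m phi x = 0.

Let dg := smooth_derivable_all smg Ux.
Let dphi := smooth_derivable_all smphi Ux.
Let dxi := smooth_derivable_all smxi Ux.
Let deta := smooth_derivable_all smeta Ux.

(** Connection matrix in the direction [u]: nabla_u F is the derivative of F along [u] plus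
    [F *m C u]. *)
Let C (u : V) : 'M[R]_d := \sum_i u 0 i *: connection_mx g i x.

Let CD u v : C (u + v) = C u + C v.
Proof. by rewrite -big_split; apply: eq_bigr => i _; rewrite mxE scalerDl. Qed.

Let CZ a u : C (a *: u) = a *: C u.
Proof. by rewrite scaler_sumr; apply: eq_bigr => i _; rewrite mxE scalerA. Qed.

Let C_sym u v : v *m C u = u *m C v.
Proof.
apply/matrixP => o k; rewrite !mxE.
under eq_bigr do rewrite summxE mulr_sumr.
under [RHS]eq_bigr do rewrite summxE mulr_sumr.
rewrite exchange_big/=; apply: eq_bigr => i _; apply: eq_bigr => j _.
rewrite !mxE (connection_torsion_free openU smg g_sym i j k Ux) !ord1.
by rewrite mulrCA.
Qed.

Let C_metric u : total_pd g x u = C u *m g x + g x *m (C u)^T.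
Proof.
rewrite /C raddf_sum mulmx_suml mulmx_sumr -big_split; apply: eq_bigr => i _.
rewrite (metric_parallel openU smg g_sym g_unit i Ux) scalerDr.
by rewrite scalemxAl scalemxAr -linearZ.
Qed.

(** [Q u] is the endomorphism nabla_u phi, and [P] is the matrix of the fundamental form. *)
Let Q u : 'M[R]_d := Dphi u + phi x *m C u - C u *m phi x.
Let P := g x *m (phi x)^T.

Let P_tr : P^T = - P.
Proof. by rewrite trmx_mul trmxK g_sym// /P phi_skew// opprK. Qed.

Let DP_tr u : (DP u)^T = - DP u.
Proof.
have dP : derivable_all (fun y => g y *m (phi y)^T) x.
  by apply: (derivable_allM dg); exact: derivable_allT.
rewrite -(total_pdT u dP) -(total_pdN u dP).
apply: (eq_on_total_pd openU) => // y Uy.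
by rewrite trmx_mul trmxK g_sym// phi_skew// opprK.
Qed.

(** Up to sign this is nabla_u Phi: [phi x *m g x] is [- P], and the metric is parallel. *)
Let QgE u : Q u *m g x = - DP u + C u *m P + P *m (C u)^T.
Proof.
have -> : DP u = - (Dphi u *m g x + phi x *m total_pd g x u).
  rewrite -(total_pdM u dphi dg) -(total_pdN u (derivable_allM dphi dg)).
  exact: (eq_on_total_pd openU).
rewrite C_metric /P phi_skew// /Q.
rewrite !(mulmxDl, mulmxDr, mulmxBl, mulmxN, mulNmx, mulmxA).
by mxring.
Qed.

Let Qg_tr u : (Q u *m g x)^T = - (Q u *m g x).
Proof.
rewrite QgE !raddfD/= raddfN/= DP_tr (trmx_mul P) (trmx_mul (C u)) P_tr trmxK.
rewrite mulmxN mulNmx.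
by mxring.
Qed.

Let A (u v w : V) : R := (v *m (Q u *m g x) *m w^T) 0 0.

Let QD u v : Q (u + v) = Q u + Q v.
Proof. by rewrite /Q CD total_pdD mulmxDl mulmxDr; mxring. Qed.

Let QZ a u : Q (a *: u) = a *: Q u.
Proof. by rewrite /Q CZ total_pdZ -scalemxAl -scalemxAr !scalerDr scalerN. Qed.

Let A_skew u v w : A u v w = - A u w v.
Proof.
rewrite /A -(tr_mx11 (v *m _ *m _)) (trmx_mul _ w^T) (trmx_mul v) trmxK mulmxA.
by rewrite Qg_tr mulmxN mulNmx mxE.
Qed.

(** The cyclic sums of nabla Phi and of the coordinate derivative of Phi agree, since
    torsion-freeness ([B_sym]) cancels the connection terms; the second sum vanishes by
    closedness. *)
Let A_cyclic u v w : A u v w + A v w u + A w u v = 0.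
Proof.
(* An opaque skew matrix replaces [P], so that its product is not reassociated below. *)
have [P' P'_tr QgE'] : exists2 P' : 'M[R]_d, P'^T = - P' &
    forall u, Q u *m g x = - DP u + C u *m P' + P' *m (C u)^T.
  by exists P; [exact: P_tr|exact: QgE].
pose B a b c : 'M[R]_1 := a *m C b *m P' *m c^T.
have E a b c : b *m (Q a *m g x) *m c^T = - (b *m DP a *m c^T) + B b a c - B c a b.
  rewrite QgE' !(mulmxDl, mulmxDr, mulmxN, mulNmx, mulmxA); congr (_ + _).
  rewrite -[RHS]tr_mx11 raddfN/= /B (trmx_mul _ b^T) (trmx_mul _ P') trmx_mul.
  by rewrite P'_tr trmxK !(mulmxN, mulNmx, mulmxA) opprK.
have B_sym a b c : B a b c = B b a c by rewrite /B C_sym.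
have : v *m (Q u *m g x) *m w^T + w *m (Q v *m g x) *m u^T +
    u *m (Q w *m g x) *m v^T = 0.
  rewrite !E (B_sym v u) (B_sym w v) (B_sym w u).
  have := Phi_closed u v w; mxlra.
by rewrite /A; mxatoms; move=> /matrixP/(_ 0 0); rewrite !mxE.
Qed.

(** In the Nijenhuis tensor, nabla phi may replace the coordinate derivative of phi, the connection
    terms cancelling by torsion-freeness ([S]). Pairing with [w] and moving the outer phi onto [w]
    by skewness gives the identity. *)
Let A_normal u v w :
  A (u *m phi x) v w - A (v *m phi x) u w
  - A v u (w *m phi x) + A u v (w *m phi x) = 0.
Proof.
have E a b : b *m (Q a *m g x) *m (w *m phi x)^T =
    - (b *m Q a *m phi x *m (g x *m w^T)).
  by rewrite trmx_mul !mulmxA -(mulmxA _ (g x)) phi_skew// mulmxN mulNmx !mulmxA.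
have F a b : b *m (Q a *m g x) *m w^T = b *m Q a *m (g x *m w^T).
  by rewrite !mulmxA.
have S : v *m Q (u *m phi x) - u *m Q (v *m phi x)
    + u *m Q v *m phi x - v *m Q u *m phi x = 0.
  rewrite /Q !(mulmxDl, mulmxDr, mulmxBl, mulmxBr, mulmxN, mulNmx, mulmxA).
  rewrite (C_sym u v) (C_sym (u *m phi x) v) (C_sym (v *m phi x) u).
  rewrite (C_sym (v *m phi x) (u *m phi x)).
  by have := phi_normal u v; mxlra.
have : (v *m Q (u *m phi x) - u *m Q (v *m phi x)
    + u *m Q v *m phi x - v *m Q u *m phi x) *m (g x *m w^T) = 0.
  by rewrite S mul0mx.
rewrite !(mulmxDl, mulmxBl, mulNmx) /A !E !F; mxatoms.
by move=> /matrixP/(_ 0 0); rewrite !mxE; lra.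
Qed.

(** As eta is closed, g(nabla_xi xi, z) = (nabla_xi eta)(z) equals (nabla_z eta)(xi), which is zero
    because xi has constant length. Differentiating phi xi = 0 then gives (nabla_xi phi) xi = - phi
    (nabla_xi xi) = 0. *)
Let A_xi w : A (xi x) (xi x) w = 0.
Proof.
(* [n] is nabla_xi xi. *)
pose n := total_pd xi x (xi x) + xi x *m C (xi x).
have etaE u : total_pd eta x u =
    C u *m g x *m (xi x)^T + g x *m (C u)^T *m (xi x)^T
    + g x *m (total_pd xi x u)^T.
  rewrite (eq_on_total_pd openU u eta_def Ux).
  rewrite (total_pdM u dg (derivable_allT dxi)) (total_pdT u dxi).
  by rewrite C_metric mulmxDl.
have n0 (z : V) : n *m g x *m z^T = 0.
  have h1 : n *m g x *m z^T = z *m total_pd eta x (xi x)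
      - z *m C (xi x) *m g x *m (xi x)^T.
    rewrite etaE -[LHS]tr_mx11 !trmx_mul trmxK g_sym// raddfD/= trmx_mul.
    by rewrite !(mulmxDr, mulmxA); mxring.
  have h2 : total_pd xi x z *m eta x + xi x *m total_pd eta x z = 0.
    rewrite -(total_pdM z dxi deta).
    by rewrite (eq_on_total_pd openU z xi_eta Ux) total_pd_cst.
  have h3 : xi x *m total_pd eta x z = xi x *m C z *m g x *m (xi x)^T
      + xi x *m C z *m g x *m (xi x)^T + total_pd xi x z *m eta x.
    rewrite etaE !mulmxDr !mulmxA; congr (_ + _ + _).
      by rewrite -[LHS]tr_mx11 !trmx_mul !trmxK g_sym// !mulmxA.
    by rewrite -[LHS]tr_mx11 !trmx_mul !trmxK g_sym// eta_def// !mulmxA.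
  (* Closedness exchanges the directions [xi x] and [z]; together [h2] and [h3] then say (nabla_z
     eta)(xi) = 0. *)
  rewrite h1 eta_closed (C_sym (xi x) z).
  move: h2 h3; move: (xi x *m total_pd eta x z) (_ *m eta x) => a b.
  move=> /eqP; rewrite addr_eq0 => /eqP ->; mxlra.
have qE : xi x *m Q (xi x) = - (n *m phi x).
  have h : total_pd xi x (xi x) *m phi x + xi x *m Dphi (xi x) = 0.
    rewrite -(total_pdM (xi x) dxi dphi).
    by rewrite (eq_on_total_pd openU (xi x) xi_phi Ux) total_pd_cst.
  rewrite /Q /n !(mulmxDr, mulmxDl, mulmxN, mulmxA) xi_phi// mul0mx addr0.
  by move: h; mxlra.
have := n0 (w *m phi x).
rewrite trmx_mul mulmxA -(mulmxA n) phi_skew// mulmxN mulNmx => e.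
by rewrite /A mulmxA qE !mulNmx -(mulmxA n) e mxE.
Qed.

(** [A] vanishes by [closed_normal_vanish], hence so does [Q], because [g] is invertible. *)
Lemma almost_contact_parallel i :
  pd i phi x = connection_mx g i x *m phi x - phi x *m connection_mx g i x.
Proof.
have A0 u v w : A u v w = 0.
  apply: (@closed_normal_vanish _ _ (fun v => v *m phi x)
    (fun v => (v *m eta x) 0 0) (xi x) A) => //.
  - move=> y; rewrite -mulmxA phi2// mulmxDr mulmxN mulmx1 mulmxA.
    by rewrite [y *m eta x in LHS]mx11_scalar mul_scalar_mx.
  - move=> a b y z; rewrite /A QD !(mulmxDl, mulmxDr); mxatoms.
    by rewrite mxE.
  - move=> a b y z; rewrite /A QZ -!(scalemxAl, scalemxAr); mxatoms.
    by rewrite mxE.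
  - move=> a b y z; rewrite /A !(mulmxDl, mulmxDr); mxatoms.
    by rewrite mxE.
  - move=> a b y z; rewrite /A -!(scalemxAl, scalemxAr); mxatoms.
    by rewrite mxE.
have Q0 : Q (delta_mx 0 i) = 0.
  suff Qg0 : Q (delta_mx 0 i) *m g x = 0.
    by rewrite -(mulmxK (g_unit Ux) (Q _)) Qg0 mul0mx.
  apply/matrixP => a b; have := A0 (delta_mx 0 i) (delta_mx 0 a) (delta_mx 0 b).
  by rewrite /A trmx_delta -rowE -colE !mxE.
have C1 : C (delta_mx 0 i) = connection_mx g i x.
  rewrite /C (bigD1 i)//= big1 ?addr0 => [|j ji].
    by rewrite mxE !eqxx scale1r.
  by rewrite mxE eqxx (negbTE ji) scale0r.
have := Q0; rewrite /Q C1 total_pd_delta; mxlra.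
Qed.

End AlmostContactParallel.

(** * Covariant derivatives of vector fields and curvature *)

Section CovariantDerivative.
Variables (R : realType) (d : nat).
Local Notation V := 'rV[R]_d.
Variables (U : set V) (g : V -> 'M[R]_d).
Hypothesis openU : open U.
Implicit Types (E F G : V -> V) (x : V).

Lemma dirE m n E (A : V -> 'M[R]_(m, n)) a b x : derivable_all A x ->
  dir E (fun y => A y a b) x = total_pd A x (E x) a b.
Proof.
move=> dA; rewrite /dir /total_pd summxE; apply: eq_bigr => i _.
by rewrite mxE pd_entry.
Qed.

Lemma lie_bracketE E F x : derivable_all E x -> derivable_all F x ->
  lie_bracket E F x = total_pd F x (E x) - total_pd E x (F x).
Proof.
move=> dE dF; apply/rowP => k.
by rewrite mxE (dirE _ _ _ dE) (dirE _ _ _ dF) !mxE.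
Qed.

Definition covariant_pd (j : 'I_d) G x : V :=
  pd j G x + G x *m connection_mx g j x.

Lemma nablaE E F x : derivable_all F x ->
  nabla g E F x = \sum_j E x 0 j *: covariant_pd j F x.
Proof.
move=> dF; apply/rowP => k; rewrite mxE dirE// summxE.
rewrite /total_pd summxE -big_split; apply: eq_bigr => i _.
rewrite !mxE /= mulrDr; congr (_ + _); rewrite mulr_sumr.
apply: eq_bigr => j _; rewrite connection_mx.unlock mxE.
by rewrite [_ * E x 0 i]mulrC -mulrA [_ * F x 0 j]mulrC.
Qed.

Lemma eq_on_nabla E F G x :
  (forall y, U y -> F y = G y) -> U x -> nabla g E F x = nabla g E G x.
Proof.
move=> FG Ux; apply/rowP => k; rewrite !mxE (FG _ Ux); congr (_ + _).
apply: eq_bigr => i _; congr (_ * _).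
by apply: (eq_on_derive _ openU) => // y Uy; rewrite FG.
Qed.

Hypothesis smg : smooth_mx_on U g.
Hypothesis g_unit : forall y, U y -> g y \in unitmx.

Lemma covariant_pd_derivable j G x : smooth_mx_on U G -> U x ->
  derivable_all (covariant_pd j G) x.
Proof.
move=> sG Ux; apply: derivable_allD; first exact: (smooth_derivable_pd openU).
apply: derivable_allM; first exact: (smooth_derivable_all sG).
exact: (connection_derivable openU smg g_unit).
Qed.

(** Ricci identity: Schwarz removes the second derivatives of [G], and the terms in its first
    derivatives are symmetric in [i] and [j]. *)
Lemma covariant_pd_comm i j G x : smooth_mx_on U G -> U x ->
  covariant_pd i (covariant_pd j G) x - covariant_pd j (covariant_pd i G) x =
  G x *m curvature_mx g i j x.
Proof.
move=> sG Ux; have dG := smooth_derivable_all sG Ux.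
have dC k : derivable_all (connection_mx g k) x.
  exact: (connection_derivable openU smg g_unit).
have dpd k : derivable_all (pd k G) x.
  exact: (smooth_derivable_pd openU).
have E k l : pd l (covariant_pd k G) x = pd l (pd k G) x +
    (pd l G x *m connection_mx g k x + G x *m pd l (connection_mx g k) x).
  rewrite /covariant_pd (pdD l (dpd k) (derivable_allM dG (dC k))).
  by rewrite (pdM l dG (dC k)).
rewrite {1}/covariant_pd E {2}/covariant_pd E (smooth_pd_comm openU i j sG Ux).
rewrite /covariant_pd /curvature_mx.
rewrite !(mulmxDl, mulmxDr, mulmxBr, mulmxN, mulmxA).
by mxring.
Qed.

(** Tensoriality in [F]: the derivatives of its components produced by the first term are cancelled
    by nabla along [e_i, F], whose components are those derivatives. What remains is
    [covariant_pd_comm]. *)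
Lemma curvatureE i F G x : smooth_mx_on U F -> smooth_mx_on U G -> U x ->
  curvature g (fun=> delta_mx 0 i) F G x =
  \sum_j F x 0 j *: (G x *m curvature_mx g i j x).
Proof.
move=> sF sG Ux; have dF := smooth_derivable_all sF Ux.
have dC k : derivable_all (covariant_pd k G) x.
  exact: covariant_pd_derivable.
have dG y : U y -> derivable_all G y by exact: smooth_derivable_all.
have dcst : derivable_all (fun _ : V => delta_mx 0 i : V) x.
  exact: derivable_all_cst.
have nabla_i (W : V -> V) y : derivable_all W y ->
    nabla g (fun=> delta_mx 0 i) W y = covariant_pd i W y.
  move=> dW; rewrite (nablaE _ dW) (bigD1 i)//= big1 ?addr0 => [|j ji].
    by rewrite mxE !eqxx scale1r.
  by rewrite mxE eqxx (negbTE ji) scale0r.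
have dFj j : forall k, derivable (fun y => F y 0 j) x (delta_mx 0 k).
  by move=> k; exact: ((derivable_mxP _ _ _).1 (dF k)).
have dS j := derivable_all_scale (dFj j) (dC j).
have T := derivable_all_sum (r := index_enum 'I_d) dS.
(* The inner [nabla] is about to be differentiated, so its formula is needed on all of [U] and not
   only at [x]. *)
have h1 : nabla g (fun=> delta_mx 0 i) (nabla g F G) x =
    covariant_pd i (fun y => \sum_j F y 0 j *: covariant_pd j G y) x.
  rewrite -(nabla_i _ x T); apply: eq_on_nabla => // y Uy.
  exact: (nablaE F (dG y Uy)).
have h2 : nabla g F (nabla g (fun=> delta_mx 0 i) G) x =
    \sum_j F x 0 j *: covariant_pd j (covariant_pd i G) x.
  rewrite -(nablaE F (dC i)); apply: eq_on_nabla => // y Uy.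
  exact: (nabla_i G y (dG y Uy)).
have h3 : nabla g (lie_bracket (fun=> delta_mx 0 i) F) G x =
    \sum_j pd i F x 0 j *: covariant_pd j G x.
  rewrite (nablaE _ (dG x Ux)).
  rewrite (lie_bracketE dcst dF) total_pd_delta; apply: eq_bigr => j _.
  by rewrite total_pd_cst subr0.
rewrite /curvature h1 h2 h3 {1}/covariant_pd (pd_sum _ i dS) mulmx_suml.
rewrite -big_split -!sumrB.
apply: eq_bigr => j _; rewrite /= (pd_scale i (dFj j) (dC j)).
rewrite -(covariant_pd_comm i j sG Ux).
rewrite -(pd_entry i 0 j dF) -scalemxAl scalerBr.
have -> : covariant_pd i (covariant_pd j G) x =
  pd i (covariant_pd j G) x + covariant_pd j G x *m connection_mx g i x by [].
rewrite (scalerDr _ (pd i _ x)); move: (pd i F x 0 j *: _) (F x 0 j *: pd i _ x)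
  (F x 0 j *: (_ *m _)) (F x 0 j *: covariant_pd j _ x) => a b c e.
by mxring.
Qed.

Lemma ricciE F G x : smooth_mx_on U F -> smooth_mx_on U G -> U x ->
  ricci g F G x =
  (F x *m ricci_mx (fun i j => curvature_mx g i j x) *m (G x)^T) 0 0.
Proof.
move=> sF sG Ux; rewrite /ricci mxE.
under eq_bigr do rewrite curvatureE// summxE.
under [RHS]eq_bigr do rewrite mxE mulr_suml.
rewrite exchange_big/= [RHS]exchange_big/=; apply: eq_bigr => j _.
under eq_bigr do rewrite !mxE mulr_sumr.
rewrite exchange_big/=; apply: eq_bigr => k _; rewrite !mxE.
rewrite mulr_sumr mulr_suml; apply: eq_bigr => i _.
by rewrite mulrCA mulrC -mulrA.
Qed.

End CovariantDerivative.

(** * Cosymplectic structures *)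

Section Pointwise.
Variables (R : realType) (d : nat).
Local Notation V := 'rV[R]_d.

Lemma app2_delta (X : 'M[R]_d) i j :
  app2 X (delta_mx 0 i) (delta_mx 0 j) = X i j.
Proof. by rewrite /app2 trmx_delta -rowE -colE !mxE. Qed.

Lemma app2_inj (X Y : 'M[R]_d) :
  (forall v w : V, app2 X v w = app2 Y v w) -> X = Y.
Proof. by move=> XY; apply/matrixP => i j; rewrite -!app2_delta. Qed.

Lemma mulmx_row_inj m (X Y : 'M[R]_(d, m)) :
  (forall v : V, v *m X = v *m Y) -> X = Y.
Proof. by move=> XY; apply/row_matrixP => i; rewrite !rowE. Qed.

(** A nonzero row [v] in the left kernel of [X] would satisfy [app2 X v v = 0]. *)
Lemma definite_unitmx (X : 'M[R]_d) :
  (forall v : V, v != 0 -> 0 < app2 X v v) -> X \in unitmx.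
Proof.
move=> Xpos; rewrite -row_free_unit -kermx_eq0; apply/eqP/row_matrixP => i.
rewrite row0; apply/eqP/negPn/negP => /Xpos.
by rewrite /app2 -row_mul mulmx_ker row0 mul0mx mxE ltxx.
Qed.

End Pointwise.

(** * Chart matrices of an almost contact metric structure *)

Section Chart.
Variables (R : realType) (d : nat) (M : manifold R d) (g : riemannian_metric M).
Variable c : chart_index M.
Local Notation V := 'rV[R]_d.
Local Notation U := (chart_im (atlas M c)).

Let openU : open U. Proof. exact: chart_im_open. Qed.

Lemma metric_sym y : U y -> (g c y)^T = g c y.
Proof.
by move=> Uy; apply/matrixP => i j; rewrite mxE -!app2_delta rm_sym.
Qed.

Lemma metric_unit y : U y -> g c y \in unitmx.
Proof. by move=> Uy; apply: definite_unitmx; exact: rm_pos. Qed.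

Variable S : almost_contact M.
Hypothesis comp : compatible g S.
Local Notation phi := (ac_phi S c).
Local Notation xi := (ac_xi S c).
Local Notation eta := (ac_eta S c).
Hypothesis xi_phi : forall y, U y -> xi y *m phi y = 0.
Hypothesis phi_eta : forall y, U y -> phi y *m eta y = 0.

Lemma ac_phi2_mx y : U y -> phi y *m phi y = - 1%:M + eta y *m xi y.
Proof.
move=> Uy; apply: mulmx_row_inj => v; have := ac_phi2 S Uy v.
rewrite /appE /app1 mulmxA => ->; rewrite mulmxDr mulmxN mulmx1 mulmxA.
by rewrite [v *m eta y in RHS]mx11_scalar mul_scalar_mx.
Qed.

Lemma ac_xi_eta_mx y : U y -> xi y *m eta y = 1%:M.
Proof.
by move=> Uy; rewrite [LHS]mx11_scalar; congr _%:M; exact: ac_eta_xi.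
Qed.

Lemma compatible_mx y : U y ->
  phi y *m g c y *m (phi y)^T = g c y - eta y *m (eta y)^T.
Proof.
move=> Uy; apply: app2_inj => v w; have := comp Uy v w.
rewrite /app2 /appE /app1 trmx_mul !mulmxA => ->.
rewrite mulmxBr mulmxBl [RHS]mxE [X in _ = _ + X]mxE; congr (_ - _).
rewrite !mulmxA -(mulmxA _ _ w^T) -trmx_mul.
by rewrite [RHS]mxE big_ord1 [X in _ = _ * X]mxE.
Qed.

(** Compatibility with xi as second argument: the left side vanishes as phi xi = 0, and eta(xi) =
    1. *)
Lemma ac_eta_mx y : U y -> eta y = g c y *m (xi y)^T.
Proof.
move=> Uy; have := congr1 (mulmx^~ (xi y)^T) (compatible_mx Uy).
rewrite /= -mulmxA -trmx_mul xi_phi// trmx0 mulmx0 mulmxBl -mulmxA -trmx_mul.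
rewrite ac_xi_eta_mx// trmx1 mulmx1 => /eqP.
by rewrite eq_sym subr_eq0 => /eqP.
Qed.

(** Compatibility with phi applied once more to the first argument: [phi y] squares to minus the
    identity up to a rank one term, and eta o phi = 0 removes the terms of rank one. *)
Lemma fundamental_skew y : U y -> g c y *m (phi y)^T = - (phi y *m g c y).
Proof.
move=> Uy; have := congr1 (mulmx (phi y)) (compatible_mx Uy).
rewrite !mulmxA ac_phi2_mx// mulmxBr mulmxA phi_eta// mul0mx subr0 => <-.
rewrite !mulmxDl !mulNmx mul1mx.
have -> : eta y *m xi y *m g c y *m (phi y)^T = 0.
  rewrite -(mulmxA (eta y)) -[xi y]trmxK -[g c y]metric_sym// -trmx_mul.
  by rewrite -ac_eta_mx// -mulmxA -trmx_mul phi_eta// trmx0 mulmx0.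
by rewrite addr0 opprK.
Qed.

Let lie_cst (v w : V) y : lie_bracket (fun=> v) (fun=> w) y = 0.
Proof.
rewrite lie_bracketE ?total_pd_cst ?subr0//; exact: derivable_all_cst.
Qed.

Let cst_smooth (v : V) : smooth_mx_on U (fun=> v).
Proof. exact: smooth_mx_on_cst. Qed.

Variable x : V.
Hypothesis Ux : U x.

Let smg : smooth_mx_on U (g c). Proof. exact: rm_smooth. Qed.
Let smphi : smooth_mx_on U phi. Proof. exact: ef_smooth. Qed.
Let smxi : smooth_mx_on U xi. Proof. exact: vf_smooth. Qed.
Let smeta : smooth_mx_on U eta. Proof. exact: of_smooth. Qed.
Let dg := smooth_derivable_all smg Ux.
Let dphi := smooth_derivable_all smphi Ux.
Let deta := smooth_derivable_all smeta Ux.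

Let total_pd_mull m n p (v : 'M[R]_(m, n)) (A : V -> 'M[R]_(n, p)) u :
  derivable_all A x ->
  total_pd (fun y => v *m A y) x u = v *m total_pd A x u /\
  derivable_all (fun y => v *m A y) x.
Proof.
move=> dA; have dv := @derivable_all_cst R d _ _ v x.
split; last exact: derivable_allM.
by rewrite (total_pdM u dv dA) total_pd_cst mul0mx add0r.
Qed.

(** As in the next two lemmas, the condition is tested on constant coordinate fields: their brackets
    vanish and only derivatives of the tensor remain. *)
Lemma eta_closed_mx : eta_closed S ->
  forall v w : V, w *m total_pd eta x v = v *m total_pd eta x w.
Proof.
move=> cl v w; have := cl c _ _ (cst_smooth v) (cst_smooth w) x Ux.
have P0 (F : V -> V) : F x = 0 -> pair1 eta F x = 0.
  by move=> F0; rewrite /pair1 /app1 F0 mul0mx mxE.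
have D (a b : V) : dir (fun=> a) (pair1 eta (fun=> b)) x =
    (b *m total_pd eta x a) 0 0.
  have [E dbe] := total_pd_mull b a deta.
  by rewrite -E -(dirE (fun=> a) 0 0 dbe).
rewrite /d1 !D (P0 _ (lie_cst v w x)) subr0 => /eqP.
rewrite mulf_eq0 invr_eq0 pnatr_eq0/= subr_eq0 => /eqP h.
by rewrite [LHS]mx11_scalar h -mx11_scalar.
Qed.

Lemma Phi_closed_mx : Phi_closed g S -> forall u v w : V,
  let DP := total_pd (fun y => g c y *m (phi y)^T) x in
  v *m DP u *m w^T + w *m DP v *m u^T + u *m DP w *m v^T = 0.
Proof.
move=> cl u v w DP.
have := cl c _ _ _ (cst_smooth u) (cst_smooth v) (cst_smooth w) x Ux.
have dP : derivable_all (fun y => g c y *m (phi y)^T) x.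
  by apply: (derivable_allM dg); exact: derivable_allT.
have P0 (F G : V -> V) : F x = 0 ->
    fundamental_form g S c x (F x) (G x) = 0.
  by move=> F0; rewrite /fundamental_form /app2 F0 !mul0mx mxE.
have D (a b e : V) :
    dir (fun=> a) (fun y => fundamental_form g S c y b e) x =
    (b *m DP a *m e^T) 0 0.
  have [E dbP] := total_pd_mull b a dP.
  have dcst := @derivable_all_cst R d _ _ e^T x.
  have dM := derivable_allM dbP dcst.
  transitivity (total_pd (fun y => b *m (g c y *m (phi y)^T) *m e^T) x a 0 0).
    rewrite -(dirE (fun=> a) 0 0 dM); congr (dir _ _ _); apply/funext => y.
    by rewrite /fundamental_form /app2 /appE trmx_mul !mulmxA.
  by rewrite (total_pdM a dbP dcst) total_pd_cst mulmx0 addr0 E.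
rewrite /d2 !D !P0 ?lie_cst// !subr0 => /eqP.
rewrite mulf_eq0 invr_eq0 pnatr_eq0/= => /eqP; mxatoms => h.
by apply/matrixP => i j; rewrite !ord1 !mxE.
Qed.

(** With eta closed, normality is the vanishing of the Nijenhuis tensor alone. *)
Lemma normal_mx : eta_closed S -> normal S -> forall v w : V,
  let Dphi := total_pd phi x in
  w *m Dphi (v *m phi x) - v *m Dphi (w *m phi x)
  + v *m Dphi w *m phi x - w *m Dphi v *m phi x = 0.
Proof.
move=> cl nor v w Dphi.
have := nor c _ _ (cst_smooth v) (cst_smooth w) x Ux.
rewrite (cl c _ _ (cst_smooth v) (cst_smooth w) x Ux) mulr0 scale0r addr0.
have dcst (a : V) := @derivable_all_cst R d _ _ a x.
have [Ev dv] := total_pd_mull v (v *m phi x) dphi.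
have [Ew dw] := total_pd_mull w (v *m phi x) dphi.
have Lc (a b : V) : derivable_all (fun y => a *m phi y) x ->
    lie_bracket (fun y => a *m phi y) (fun=> b) x = - (a *m Dphi b).
  move=> da; rewrite (lie_bracketE da (dcst b)) total_pd_cst sub0r.
  by have [-> _] := total_pd_mull a b dphi.
have Lr (a b : V) : derivable_all (fun y => a *m phi y) x ->
    lie_bracket (fun=> b) (fun y => a *m phi y) x = a *m Dphi b.
  move=> da; rewrite (lie_bracketE (dcst b) da) total_pd_cst subr0.
  by have [-> _] := total_pd_mull a b dphi.
rewrite /nijenhuis /applyE /appE lie_cst !mul0mx add0r.
rewrite (Lc _ _ dv) (Lr _ _ dw) (lie_bracketE dv dw).
have [-> _] := total_pd_mull w (v *m phi x) dphi.
have [-> _] := total_pd_mull v (w *m phi x) dphi.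
by rewrite mulNmx opprK.
Qed.

Lemma cosymplectic_parallel i :
  eta_closed S -> Phi_closed g S -> normal S ->
  pd i phi x = connection_mx (g c) i x *m phi x
    - phi x *m connection_mx (g c) i x.
Proof.
move=> cle clP nor.
apply: (almost_contact_parallel openU smg smphi smxi smeta metric_sym metric_unit
  ac_phi2_mx fundamental_skew xi_phi ac_eta_mx ac_xi_eta_mx Ux).
- exact: eta_closed_mx.
- exact: Phi_closed_mx.
- exact: normal_mx.
Qed.

End Chart.

(** * The three structures together *)

(** Choosing (a, b, c) to be a cyclic permutation of (0, 1, 2) makes [c] the only index with a
    nonzero symbol. *)
Lemma epsilon_cyclic (R : realType) (c : 'I_3) : exists a b : 'I_3,
  [/\ a != b,
    forall (W : lmodType R) (f : 'I_3 -> W),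
      \sum_k epsilon R a b k *: f k = f c &
    forall (W : lmodType R) (f : 'I_3 -> W),
      \sum_k epsilon R b a k *: f k = - f c].
Proof.
pose o0 : 'I_3 := Ordinal (isT : 0 < 3)%N.
pose o1 : 'I_3 := Ordinal (isT : 1 < 3)%N.
pose o2 : 'I_3 := Ordinal (isT : 2 < 3)%N.
have [->|->|->] : [\/ c = o0, c = o1 | c = o2].
  by case: c => [[|[|[|//]]] ?]; [apply: Or31|apply: Or32|apply: Or33];
    apply: val_inj.
- exists o1, o2; split=> // W f;
    rewrite !big_ord_recl big_ord0 /epsilon /= !scale0r !(add0r, addr0) -signr_odd
      /= ?expr0 ?expr1 ?scaleN1r ?scale1r;
    [congr (f _)|congr (- f _)]; exact: val_inj.
- exists o2, o0; split=> // W f;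
    rewrite !big_ord_recl big_ord0 /epsilon /= !scale0r !(add0r, addr0) -signr_odd
      /= ?expr0 ?expr1 ?scaleN1r ?scale1r;
    [congr (f _)|congr (- f _)]; exact: val_inj.
- exists o0, o1; split=> // W f;
    rewrite !big_ord_recl big_ord0 /epsilon /= !scale0r !(add0r, addr0) -signr_odd
      /= ?expr0 ?expr1 ?scaleN1r ?scale1r;
    [congr (f _)|congr (- f _)]; exact: val_inj.
Qed.

Lemma epsilon_diag (R : realType) (a k : 'I_3) : epsilon R a a k = 0.
Proof. by rewrite /epsilon /= inE eqxx. Qed.

Theorem corollary3p10 (R : realType) (n : nat) (M : manifold R (4 * n + 3))
    (S : almost_3contact_metric M) (cosymplectic : three_cosymplectic S) :
  ricci_flat (a3_metric S).
Proof.
move=> c F G smF smG x Ux; pose g := a3_metric S; pose T a := a3_str S a.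
pose U := chart_im (atlas M c).
have openU : open U by exact: chart_im_open.
have xi_phi a y : U y -> ac_xi (T a) c y *m ac_phi (T a) c y = 0.
  move=> Uy; have := a3_phi_xi S a a Uy; rewrite /appE => ->.
  by rewrite big1// => k _; rewrite epsilon_diag scale0r.
have phi_eta a y : U y -> ac_phi (T a) c y *m ac_eta (T a) c y = 0.
  move=> Uy; apply: mulmx_row_inj => v; rewrite mulmx0 mulmxA [LHS]mx11_scalar.
  have := a3_eta_phi S a a Uy v; rewrite /appE /app1 => ->.
  by rewrite big1 ?raddf0// => k _; rewrite epsilon_diag mul0r.
have smg : smooth_mx_on U (g c) by exact: rm_smooth.
have g_sym := @metric_sym _ _ _ g c.
have g_unit := @metric_unit _ _ _ g c.
pose Om i j := curvature_mx (g c) i j x.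
have comm a i j : Om i j *m ac_phi (T a) c x = ac_phi (T a) c x *m Om i j.
  apply: (curvature_comm openU smg g_unit) => //; first exact: ef_smooth.
  move=> k y Uy; have [cle clP nor] := cosymplectic a.
  exact: (cosymplectic_parallel (a3_compatible S a) (xi_phi a) (phi_eta a) Uy).
have OmT i j : Om i j *m g c x = - (g c x *m (Om i j)^T).
  exact: (curvature_metric openU smg g_sym g_unit).
have xiOm a i j : ac_xi (T a) c x *m Om i j = 0.
  set xi := ac_xi (T a) c x; set eta := ac_eta (T a) c x.
  have etaE : eta = g c x *m xi^T.
    exact: (ac_eta_mx (a3_compatible S a) (xi_phi a) Ux).
  (* g(R xi, xi) = 0 because R is skew for the metric. *)
  have e0 : xi *m Om i j *m eta = 0.
    have e : xi *m Om i j *m eta = - (xi *m Om i j *m eta).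
      rewrite {1}etaE mulmxA -(mulmxA xi) OmT mulmxN mulNmx; congr (- _).
      by rewrite -[LHS]tr_mx11 !trmx_mul !trmxK g_sym// etaE !mulmxA.
    by move: e; mxlra.
  (* R commutes with phi, so phi (R xi) = R (phi xi) = 0; applying phi again gives - R xi + eta(R
     xi) xi, whose last term is zero by [e0]. *)
  have := congr1 (mulmx^~ (ac_phi (T a) c x)) (congr1 (mulmx xi) (comm a i j)).
  rewrite /= [xi *m (_ *m Om i j)]mulmxA xi_phi// !mul0mx -!mulmxA ac_phi2_mx//.
  rewrite mulmxDr mulmxN mulmx1 mulmxDr mulmxN !mulmxA e0 mul0mx addr0.
  by move=> /eqP; rewrite oppr_eq0 => /eqP.
have rank1 a b (v : 'rV[R]_(4 * n + 3)) :
    app1 (ac_eta (T b) c x) v *: ac_xi (T a) c x =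
    v *m (ac_eta (T b) c x *m ac_xi (T a) c x).
  by rewrite mulmxA [v *m _ in RHS]mx11_scalar mul_scalar_mx.
(* The factors come in reversed order because [appE] multiplies rows on the right. *)
have quaternion k : exists a b : 'I_3,
    ac_phi (T b) c x *m ac_phi (T a) c x - ac_eta (T b) c x *m ac_xi (T a) c x
      = ac_phi (T k) c x /\
    ac_phi (T a) c x *m ac_phi (T b) c x - ac_eta (T a) c x *m ac_xi (T b) c x
      = - ac_phi (T k) c x.
  have [a [b [ab e1 e2]]] := epsilon_cyclic R k; exists a, b.
  split; apply: mulmx_row_inj => v; rewrite mulmxBr -rank1 mulmxA.
    have := a3_phi_phi S a b Ux v; rewrite (negbTE ab) scale0r subr0.
    by rewrite (e1 _ (fun k => appE (ac_phi (T k) c x) v)).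
  have := a3_phi_phi S b a Ux v; rewrite eq_sym (negbTE ab) scale0r subr0.
  by rewrite (e2 _ (fun k => appE (ac_phi (T k) c x) v)) mulmxN.
have trphi k i j : \tr (Om i j *m ac_phi (T k) c x) = 0.
  have [a [b [e1 e2]]] := quaternion k.
  exact: (trace_product_commutator (comm a i j) (xiOm a i j) (xiOm b i j) e1 e2).
have Om_anti i j : Om j i = - Om i j by exact: curvature_anti.
have Om_bianchi i j k l : Om i j k l + Om j k i l + Om k i j l = 0.
  exact: (curvature_bianchi openU smg g_sym).
pose Rc := ricci_mx Om.
have Rsym : Rc^T = Rc.
  apply: (ricci_mx_sym Om_anti Om_bianchi) => i j.
  exact: (curvature_trace openU smg g_sym g_unit).
(* Transposing the symmetric matrix [Rc *m phi^T] and using [Rsym] turns symmetry into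
   commutation. *)
have Rphi a : Rc *m (ac_phi (T a) c x)^T = ac_phi (T a) c x *m Rc.
  rewrite -(ricci_mx_comm_sym Om_anti Om_bianchi (comm a) (trphi a)).
  by rewrite trmx_mul trmxK -/Rc Rsym.
have Rxi a : Rc *m (ac_xi (T a) c x)^T = 0 by exact/ricci_mx_ker/xiOm.
have R0 : Rc = 0.
  (* A single quaternionic triple is enough; any index may serve as [k]. *)
  have k : 'I_3 := ord0; have [a [b [e1 e2]]] := quaternion k.
  exact: (sym_commuting_quaternion0 Rsym (Rphi a) (Rphi b) (Rphi k)
    (Rxi a) (Rxi b) (Rxi k) e1 e2 (ac_phi2_mx (T k) Ux)).
by rewrite (ricciE openU smg g_unit smF smG Ux) -/Om -/Rc R0 mulmx0 mul0mx mxE.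
Qed.
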